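(* Let $\alpha\in(0,0.3738)$ and $\beta\in(1,2)$. If the temporal stepsize $\tau$ and the spatial stepsize $h$ are sufficiently small, then the fully discrete L1-2 scheme in the context is numerically stable, and its solution satisfies $$\|U^n\|_h\le\|U^0\|_h+C^{(\alpha)}\max_{1\le k\le n}\big\{(k\tau)^{\alpha}\|f^k\|_h\big\},\qquad 1\le n\le N,$$ with $C^{(\alpha)}=\max\Big\{\frac{6\Gamma(1-\alpha)}{\tilde a^{\alpha}},\frac{3\Gamma(2-\alpha)}{\alpha\tilde a^{\alpha}}\Big\}$.
   Context: Time grid: $\tilde a>0$, $T>\tilde a$, $N\in\mathbb{Z}^+$, $\tau=(T-\tilde a)/N$, $t_k=\tilde a+k\tau$. L1-2 coefficients: $a^{(\alpha)}_{i,k}=(\log\frac{t_k}{t_{i-1}})^{1-\alpha}-(\log\frac{t_k}{t_i})^{1-\alpha}$; for $i\ge2$, $b^{(\alpha)}_{i,k}=\frac{1}{\log\frac{t_i}{t_{i-2}}}\{\log\frac{t_i}{t_{i-1}}[(\log\frac{t_k}{t_i})^{1-\alpha}+(\log\frac{t_k}{t_{i-1}})^{1-\alpha}]+\frac{2}{2-\alpha}[(\log\frac{t_k}{t_i})^{2-\alpha}-(\log\frac{t_k}{t_{i-1}})^{2-\alpha}]\}$; $c^{(\alpha)}_{1,1}=\frac{a^{(\alpha)}_{1,1}}{\Gamma(2-\alpha)\log\frac{t_1}{t_0}}$; for $k\ge2$: $c^{(\alpha)}_{1,k}=\frac{a^{(\alpha)}_{1,k}+b^{(\alpha)}_{2,k}}{\Gamma(2-\alpha)\log\frac{t_1}{t_0}}$,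 $c^{(\alpha)}_{i,k}=\frac{a^{(\alpha)}_{i,k}-b^{(\alpha)}_{i,k}+b^{(\alpha)}_{i+1,k}}{\Gamma(2-\alpha)\log\frac{t_i}{t_{i-1}}}$ ($2\le i\le k-1$), $c^{(\alpha)}_{k,k}=\frac{a^{(\alpha)}_{k,k}-b^{(\alpha)}_{k,k}}{\Gamma(2-\alpha)\log\frac{t_k}{t_{k-1}}}$. Space grid: $a<b$, $M\in\mathbb{Z}^+$, $h=(b-a)/M$, $x_j=a+jh$; $\|w\|_h^2=h\sum_{j=1}^{M-1}w_j^2$. Riesz coefficients: $g^{(\beta)}_k=(-1)^k\binom{\beta}{k}$, $\Psi_\beta=\frac{1}{2\cos(\pi\beta/2)}$, $r^{(\beta)}_0=2\Psi_\beta(\frac{\beta}{2}g^{(\beta)}_1+\frac{2-\beta}{2}g^{(\beta)}_0)$, $r^{(\beta)}_1=\Psi_\beta(\frac{\beta}{2}g^{(\beta)}_0+\frac{2-\beta}{2}g^{(\beta)}_1+\frac{\beta}{2}g^{(\beta)}_2)$, $r^{(\beta)}_k=\Psi_\beta(\frac{\beta}{2}g^{(\beta)}_{k+1}+\frac{2-\beta}{2}g^{(\beta)}_k)$ ($k\ge2$), $r^{(\beta)}_{-k}=r^{(\beta)}_k$. Scheme (with $f^n_j=f(x_j,t_n)$, $f^n=(f^n_j)_j$): $c^{(\alpha)}_{1,1}U^1_j-c^{(\alpha)}_{1,1}U^0_j+h^{-\beta}\sum_{k=0}^Mr^{(\beta)}_{j-k}U^1_k=f^1_j$; for $2\le n\le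 N$: $c^{(\alpha)}_{n,n}U^n_j+\sum_{i=1}^{n-1}(c^{(\alpha)}_{i,n}-c^{(\alpha)}_{i+1,n})U^i_j-c^{(\alpha)}_{1,n}U^0_j+h^{-\beta}\sum_{k=0}^Mr^{(\beta)}_{j-k}U^n_k=f^n_j$; for $1\le j\le M-1$; $U^0_j=u_0(x_j)$; $U^n_0=U^n_M=0$. *)

(* Defs.v *)
From Stdlib Require Import Reals List Arith ZArith.
From Coquelicot Require Import Coquelicot.
Open Scope R_scope.

Definition Gamma (s : R) : R :=
  RInt_gen (fun t => Rpower t (s - 1) * exp (- t)) (at_right 0) (Rbar_locally p_infty).

(* real power x^p for x >= 0, with the convention 0^p = 0 (used for p > 0). *)
Definition rpow (x p : R) : R := if Rlt_dec 0 x then Rpower x p else 0.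

Definition sumR (F : nat -> R) (m n : nat) : R :=
  fold_right Rplus 0 (map F (seq m (S n - m))).

(* max_{i=m}^{n} F i for nonnegative quantities (0 if range empty) *)
Definition maxR (F : nat -> R) (m n : nat) : R :=
  fold_right Rmax 0 (map F (seq m (S n - m))).

Section L12.
Variables (al at0 T : R) (N : nat).
Definition tau : R := (T - at0) / INR N.
Definition tk (k : nat) : R := at0 + INR k * tau.
Definition Lg (k i : nat) : R := ln (tk k / tk i).

Definition acoef (i k : nat) : R :=
  rpow (Lg k (i - 1)) (1 - al) - rpow (Lg k i) (1 - al).

(* defined for i >= 2 *)
Definition bcoef (i k : nat) : R :=
  / ln (tk i / tk (i - 2)) *
  ( ln (tk i / tk (i - 1)) * (rpow (Lg k i) (1 - al) + rpow (Lg k (i - 1)) (1 - al))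
    + 2 / (2 - al) * (rpow (Lg k i) (2 - al) - rpow (Lg k (i - 1)) (2 - al)) ).

Definition ccoef (i k : nat) : R :=
  if (k =? 1)%nat then acoef 1 1 / (Gamma (2 - al) * ln (tk 1 / tk 0))
  else if (i =? 1)%nat then (acoef 1 k + bcoef 2 k) / (Gamma (2 - al) * ln (tk 1 / tk 0))
  else if (i =? k)%nat then (acoef k k - bcoef k k) / (Gamma (2 - al) * ln (tk k / tk (k - 1)))
  else (acoef i k - bcoef i k + bcoef (i + 1) k) / (Gamma (2 - al) * ln (tk i / tk (i - 1))).
End L12.

(* g_k = (-1)^k binom(beta, k) = (-1)^k prod_{i<k} (beta - i) / k! *)
Definition gcoef (be : R) (k : nat) : R :=
  (-1) ^ k * (fold_right Rmult 1 (map (fun i => be - INR i) (seq 0 k)) / INR (fact k)).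

Definition Psi (be : R) : R := / (2 * cos (PI * be / 2)).

Definition rcoef_nat (be : R) (k : nat) : R :=
  match k with
  | O => 2 * Psi be * (be / 2 * gcoef be 1 + (2 - be) / 2 * gcoef be 0)
  | S O => Psi be * (be / 2 * gcoef be 0 + (2 - be) / 2 * gcoef be 1 + be / 2 * gcoef be 2)
  | _ => Psi be * (be / 2 * gcoef be (S k) + (2 - be) / 2 * gcoef be k)
  end.

Definition rcoef (be : R) (m : Z) : R := rcoef_nat be (Z.abs_nat m).

Definition hstep (a b : R) (M : nat) : R := (b - a) / INR M.
Definition xj (a b : R) (M j : nat) : R := a + INR j * hstep a b M.

Definition normh (a b : R) (M : nat) (w : nat -> R) : R :=
  sqrt (hstep a b M * sumR (fun j => w j ^ 2) 1 (M - 1)).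

Definition Riesz (be a b : R) (M : nat) (W : nat -> R) (j : nat) : R :=
  Rpower (hstep a b M) (- be) *
  sumR (fun k => rcoef be (Z.of_nat j - Z.of_nat k) * W k) 0 M.

Definition scheme (al be at0 T a b : R) (N M : nat)
  (u0 : R -> R) (f : R -> R -> R) (U : nat -> nat -> R) : Prop :=
  (forall j, (1 <= j <= M - 1)%nat ->
     ccoef al at0 T N 1 1 * U 1%nat j - ccoef al at0 T N 1 1 * U 0%nat j
     + Riesz be a b M (U 1%nat) j = f (xj a b M j) (tk at0 T N 1)) /\
  (forall n j, (2 <= n <= N)%nat -> (1 <= j <= M - 1)%nat ->
     ccoef al at0 T N n n * U n j
     + sumR (fun i => (ccoef al at0 T N i n - ccoef al at0 T N (i + 1) n) * U i j) 1 (n - 1)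
     - ccoef al at0 T N 1 n * U 0%nat j
     + Riesz be a b M (U n) j = f (xj a b M j) (tk at0 T N n)) /\
  (forall j, (1 <= j <= M - 1)%nat -> U 0%nat j = u0 (xj a b M j)) /\
  (forall n, (n <= N)%nat -> U n 0%nat = 0 /\ U n M = 0).

Definition Cal (al at0 : R) : R :=
  Rmax (6 * Gamma (1 - al) / Rpower at0 al) (3 * Gamma (2 - al) / (al * Rpower at0 al)).

(* Main.v *)
Require Import Defs.
From Stdlib Require Import Reals List Arith ZArith Lra Lia Psatz.
From Coquelicot Require Import Coquelicot.
Open Scope R_scope.

(** Put [p = 1 - alpha], [s_i = log (t_n / t_i)] and [l_i = s_{i-1} - s_i]. Up to the
    factor [Gamma (1 + p)], the weight [c_{i,n}] is the slope of [x^p] over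
    [s_i, s_{i-1}] plus a difference of nonnegative trapezoidal-rule corrections.
    The steps [l_i] decrease in [i] with ratios tending uniformly to 1 as [tau -> 0],
    and [c_{i,n}] is then increasing in [i]: away from the last levels the decrease
    of the slope of [x^p] beats the corrections by a definite factor, and for
    [c_{n-2,n} <= c_{n-1,n}] one passes to the limit of equal steps, where the
    inequality reads [2^p (3p+15) - (3p+9) - 3^p (p+7) > 0]; the root of this
    expression is what forces [alpha < 0.3738]. Moreover
    [Gamma (1 + p) c_{1,n} >= (alpha / 3) s_0^(-alpha)] and [s_0 <= n tau / at0].

    The Riesz matrix has nonpositive off-diagonal entries and nonnegative row sums,
    hence is positive semidefinite. Testing the scheme against [U^n] thus bounds
    [c_{n,n} |U^n|] by a combination of the earlier norms with nonnegative weights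
    of total mass [c_{n,n}], and induction on [n] concludes. *)

(** * Numerical bounds at the threshold *)

(** The mean value theorem for [g - f]; iterated on successive derivatives, it yields the
    Taylor-type bounds below. *)
Lemma le_of_derive_le (f g f' g' : R -> R) (x y : R) :
  x <= y ->
  (forall t, x <= t <= y -> is_derive f t (f' t)) ->
  (forall t, x <= t <= y -> is_derive g t (g' t)) ->
  (forall t, x <= t <= y -> f' t <= g' t) ->
  f x <= g x -> f y <= g y.
Proof.
intros xy df dg le0 lex.
destruct (MVT_gen (fun t => g t - f t) x y (fun t => g' t - f' t)) as [c [hc e]].
- intros t; rewrite Rmin_left, Rmax_right by lra; intros ht.
  apply (is_derive_minus g f); [apply dg | apply df]; lra.
- intros t; rewrite Rmin_left, Rmax_right by lra; intros ht.
  apply continuity_pt_filterlim, (ex_derive_continuous (fun t => g t - f t)).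
  exists (g' t - f' t); apply (is_derive_minus g f); [apply dg | apply df]; lra.
- rewrite Rmin_left, Rmax_right in hc by lra; cbv beta in e.
  generalize (le0 c hc); nra.
Qed.

Lemma exp_ge_cubic (x : R) : 0 <= x ->
  1 + x + x ^ 2 / 2 + x ^ 3 / 6 <= exp x /\
  1 - x + x ^ 2 / 2 - x ^ 3 / 6 <= exp (- x).
Proof.
intros x0; split.
- apply (le_of_derive_le (fun x => 1 + x + x ^ 2 / 2 + x ^ 3 / 6) exp
    (fun x => 1 + x + x ^ 2 / 2) exp 0 x x0); try lra.
  + intros t _; auto_derive; trivial; field.
  + intros t _; apply is_derive_exp.
  + intros u [u0 _].
    apply (le_of_derive_le (fun x => 1 + x + x ^ 2 / 2) exp
      (fun x => 1 + x) exp 0 u u0); try lra.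
    * intros t _; auto_derive; trivial; field.
    * intros t _; apply is_derive_exp.
    * intros t _; apply exp_ineq1_le.
    * rewrite exp_0; lra.
  + rewrite exp_0; lra.
- apply (le_of_derive_le (fun x => 1 - x + x ^ 2 / 2 - x ^ 3 / 6) (fun x => exp (- x))
    (fun x => - 1 + x - x ^ 2 / 2) (fun x => - exp (- x)) 0 x x0); try lra.
  + intros t _; auto_derive; trivial; field.
  + intros t _; auto_derive; trivial; field.
  + intros u [u0 _].
    cut (exp (- u) <= 1 - u + u ^ 2 / 2); [lra |].
    apply (le_of_derive_le (fun x => exp (- x)) (fun x => 1 - x + x ^ 2 / 2)
      (fun x => - exp (- x)) (fun x => - 1 + x) 0 u u0); try lra.
    * intros t _; auto_derive; trivial; field.
    * intros t _; auto_derive; trivial; field.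
    * intros t _; generalize (exp_ineq1_le (- t)); lra.
    * rewrite Ropp_0, exp_0; lra.
  + rewrite Ropp_0, exp_0; lra.
Qed.

(** At a sixteenth of the argument the cubic Taylor polynomial is sharp enough for four-digit bounds
    on logarithms, which become rational inequalities. *)
Lemma exp_16 (x : R) : exp x = exp (x / 16) ^ 16.
Proof.
rewrite <- Rpower_pow by apply exp_pos; unfold Rpower; rewrite ln_exp.
f_equal; simpl; field.
Qed.

Lemma ln_le_of_cubic (x y : R) : 0 <= y -> 0 < x ->
  x <= (1 + y / 16 + (y / 16) ^ 2 / 2 + (y / 16) ^ 3 / 6) ^ 16 -> ln x <= y.
Proof.
intros y0 x0 h; rewrite <- (ln_exp y); apply ln_le; trivial.
apply Rle_trans with (1 := h); clear h; rewrite (exp_16 y).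
apply pow_incr; destruct (exp_ge_cubic (y / 16)); [lra |].
split; trivial. generalize (pow_le (y / 16) 3) (pow2_ge_0 (y / 16)); lra.
Qed.

Lemma ln_ge_of_cubic (x y : R) : 0 <= y <= 16 -> 0 < x ->
  1 <= x * (1 - y / 16 + (y / 16) ^ 2 / 2 - (y / 16) ^ 3 / 6) ^ 16 -> y <= ln x.
Proof.
intros y0 x0 h; rewrite <- (ln_exp y); apply ln_le; [apply exp_pos |].
assert (h1 : (1 - y / 16 + (y / 16) ^ 2 / 2 - (y / 16) ^ 3 / 6) ^ 16 <= exp (- y)).
  clear h; rewrite (exp_16 (- y)).
  apply pow_incr; destruct (exp_ge_cubic (y / 16)) as [_ h1]; [lra |].
  replace (- y / 16) with (- (y / 16)) by field.
  split; trivial.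
  assert (0 <= y / 16 <= 1) by lra; generalize (y / 16) H; clear; intros; nra.
apply Rmult_le_reg_r with (exp (- y)); [apply exp_pos |].
rewrite <- exp_plus, Rplus_opp_r, exp_0.
apply Rle_trans with (1 := h); apply Rmult_le_compat_l; trivial.
now apply Rlt_le.
Qed.

Lemma ln2_bounds : 0.6931 <= ln 2 <= 0.6932.
Proof. split; [apply ln_ge_of_cubic | apply ln_le_of_cubic]; lra. Qed.

Lemma ln3_bounds : 1.098 <= ln 3 <= 1.0987.
Proof. split; [apply ln_ge_of_cubic | apply ln_le_of_cubic]; lra. Qed.

Lemma Rpower_5_8_pow (x : R) : 0 < x -> Rpower x (5 / 8) ^ 8 = x ^ 5.
Proof.
intros x0; rewrite <- !Rpower_pow, Rpower_mult; trivial; [| apply exp_pos].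
f_equal; simpl; field.
Qed.

Lemma pow8_le (x y : R) : 0 <= x -> 0 <= y -> x ^ 8 <= y ^ 8 -> x <= y.
Proof.
intros x0 y0 h; destruct (Rle_or_lt x y) as [|lt]; trivial.
assert (y ^ 8 < x ^ 8); [| lra].
replace (y ^ 8) with (((y ^ 2) ^ 2) ^ 2) by ring.
replace (x ^ 8) with (((x ^ 2) ^ 2) ^ 2) by ring.
assert (h2 : forall u v, 0 <= u -> u < v -> u ^ 2 < v ^ 2) by (intros; nra).
repeat (apply h2; try apply pow2_ge_0); trivial.
Qed.

(* The exponent 0.6262 = 5/8 + 0.0012 is split so that the irrational powers
   reduce to eighth roots and a first-order expansion. *)
Lemma Rpower_2_lower : 1.5434934 <= Rpower 2 0.6262.
Proof.
replace 0.6262 with (5 / 8 + 0.0012) by lra; rewrite Rpower_plus.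
assert (1.5422108 <= Rpower 2 (5 / 8)).
  apply pow8_le; [lra | apply Rlt_le, exp_pos | rewrite Rpower_5_8_pow; lra].
assert (1 + 0.0012 * 0.6931 <= Rpower 2 0.0012).
  unfold Rpower; apply Rle_trans with (2 := exp_ineq1_le _).
  generalize ln2_bounds; lra.
nra.
Qed.

Lemma Rpower_3_upper : Rpower 3 0.6262 <= 1.9896368.
Proof.
replace 0.6262 with (5 / 8 + 0.0012) by lra; rewrite Rpower_plus.
assert (Rpower 3 (5 / 8) <= 1.9870134).
  apply pow8_le; [apply Rlt_le, exp_pos | lra | rewrite Rpower_5_8_pow; lra].
assert (0 < Rpower 3 (5 / 8)) by apply exp_pos.
(* An upper bound on an exponential, obtained from the linear lower bound on its reciprocal. *)
assert (h : Rpower 3 0.0012 * (1 - 0.0012 * 1.0987) <= 1).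
  assert (e : exp (0.0012 * ln 3) * exp (- (0.0012 * ln 3)) = 1).
    now rewrite <- exp_plus, Rplus_opp_r, exp_0.
  rewrite <- e; unfold Rpower.
  apply Rmult_le_compat_l; [apply Rlt_le, exp_pos |].
  apply Rle_trans with (2 := exp_ineq1_le _).
  generalize ln3_bounds; lra.
assert (0 < Rpower 3 0.0012) by apply exp_pos.
assert (Rpower 3 0.0012 <= 1.00132019) by lra.
apply Rle_trans with (1.9870134 * 1.00132019); [| lra].
apply Rmult_le_compat; lra.
Qed.

Definition thr (p : R) : R :=
  Rpower 2 p * (3 * p + 15) - (3 * p + 9) - Rpower 3 p * (p + 7).

(* [thr] is strictly concave on [0.6262, 1], vanishes at 1 and is
   slightly positive (about 7e-5) at 0.6262. *)
Lemma thr_pos (p : R) : 0.6262 < p < 1 -> 0 < thr p.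
Proof.
intros hp; destruct (Rlt_or_le 0 (thr p)) as [|neg]; trivial; exfalso.
pose (d := fun p => Rpower 2 p * (ln 2 * (3 * p + 15) + 3) - 3 - Rpower 3 p * (ln 3 * (p + 7) + 1)).
pose (d2 := fun p => Rpower 2 p * (ln 2 ^ 2 * (3 * p + 15) + 6 * ln 2)
   - Rpower 3 p * (ln 3 ^ 2 * (p + 7) + 2 * ln 3)).
assert (h1 : forall t, is_derive thr t (d t)).
  intros t; unfold thr, d, Rpower; auto_derive; trivial; ring.
assert (h2 : forall t, is_derive d t (d2 t)).
  intros t; unfold d, d2, Rpower; auto_derive; trivial; ring.
assert (neg2 : forall t, 0.6262 <= t <= 1 -> d2 t < 0).
  intros t ht; unfold d2.
  (* With [Rpower 2 t] factored out, the sign follows from 12.9 < 1.2 * 11.3. *)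
  assert (e : Rpower 3 t = Rpower 2 t * Rpower (3 / 2) t).
    rewrite Rpower_mult_distr by lra; f_equal; lra.
  rewrite e.
  assert (1.2 <= Rpower (3 / 2) t).
    apply Rle_trans with (Rpower (3 / 2) (/ 2)); [| apply Rle_Rpower; lra].
    rewrite Rpower_sqrt by lra; rewrite <- (sqrt_square 1.2) by lra.
    apply sqrt_le_1_alt; lra.
  assert (0 < Rpower 2 t) by apply exp_pos.
  assert (ln 2 ^ 2 * (3 * t + 15) + 6 * ln 2 <= 12.9).
    generalize ln2_bounds; intros; assert (ln 2 ^ 2 <= 0.4806) by nra; nra.
  assert (11.3 <= ln 3 ^ 2 * (t + 7) + 2 * ln 3).
    generalize ln3_bounds; intros; assert (1.2 <= ln 3 ^ 2) by nra; nra.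
  assert (12.9 < Rpower (3 / 2) t * (ln 3 ^ 2 * (t + 7) + 2 * ln 3)) by nra.
  nra.
assert (mvt : forall f g u v, u < v -> (forall t, is_derive f t (g t)) ->
    exists c, u <= c <= v /\ f v - f u = g c * (v - u)).
  intros f g u v uv hd; destruct (MVT_gen f u v g) as [c [hc e]].
  - intros t _; apply hd.
  - intros t _; apply continuity_pt_filterlim, (ex_derive_continuous f); exists (g t); apply hd.
  - exists c; rewrite Rmin_left, Rmax_right in hc by lra; auto.
assert (e1 : thr 1 = 0) by (unfold thr; rewrite !Rpower_1; lra).
assert (e0 : 0 < thr 0.6262).
  unfold thr; generalize Rpower_2_lower Rpower_3_upper; lra.
(* If [thr p <= 0], the mean slope is negative on [0.6262, p] and nonnegative on [p, 1], so [d]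
   increases somewhere, against [d2 < 0]. *)
destruct (mvt thr d 0.6262 p) as [c1 [hc1 ec1]]; [lra | auto |].
destruct (mvt thr d p 1) as [c2 [hc2 ec2]]; [lra | auto |].
assert (d c1 < 0) by nra.
assert (0 <= d c2) by nra.
assert (c1 < c2).
  destruct (Rle_lt_or_eq_dec c1 c2); [lra | trivial |].
  subst; lra.
destruct (mvt d d2 c1 c2) as [c3 [hc3 ec3]]; auto.
generalize (neg2 c3); nra.
Qed.

(** * Positivity of Gamma *)

Definition gamma_fun (p t : R) : R := Rpower t p * exp (- t).

Lemma gamma_fun_pos p t : 0 < gamma_fun p t.
Proof. apply Rmult_lt_0_compat; apply exp_pos. Qed.

Lemma gamma_fun_cont p t : 0 < t -> continuous (gamma_fun p) t.
Proof.
intros t0; apply (ex_derive_continuous (gamma_fun p)).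
unfold gamma_fun, Rpower; auto_derive; lra.
Qed.

Lemma gamma_fun_ex_RInt p x y : 0 < x -> 0 < y -> ex_RInt (gamma_fun p) x y.
Proof.
intros x0 y0; apply (ex_RInt_continuous (gamma_fun p)); intros z [hz _].
apply gamma_fun_cont; apply Rlt_le_trans with (2 := hz).
now apply Rmin_glb_lt.
Qed.

(** Since t^p <= 1 + t, the integrand is dominated by (1 + t) e^(-t), with primitive -(2 + t)
    e^(-t); and (2 + x) e^(-x) <= 2. *)
Lemma RInt_gamma_fun_le p x y : 0 < p < 1 -> 0 < x <= y -> RInt (gamma_fun p) x y <= 2.
Proof.
intros hp [x0 xy].
pose (F := fun t => - ((2 + t) * exp (- t))).
assert (h : is_RInt (fun t => (1 + t) * exp (- t)) x y (minus (F y) (F x))).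
  apply (is_RInt_derive F).
  - intros t _; unfold F; auto_derive; trivial; ring.
  - intros t _; apply (ex_derive_continuous (fun t => (1 + t) * exp (- t))).
    now auto_derive.
apply Rle_trans with (minus (F y) (F x)).
- rewrite <- (is_RInt_unique _ _ _ _ h).
  apply RInt_le; trivial.
  + apply gamma_fun_ex_RInt; lra.
  + eexists; exact h.
  + intros t ht; apply Rmult_le_compat_r; [apply Rlt_le, exp_pos |].
    destruct (Rle_or_lt t 1).
    * apply Rle_trans with (Rpower 1 p); [apply Rle_Rpower_l; lra |].
      unfold Rpower; rewrite ln_1, Rmult_0_r, exp_0; lra.
    * apply Rle_trans with (Rpower t 1); [apply Rle_Rpower; lra |].
      rewrite Rpower_1; lra.
- unfold minus, plus, opp, F; simpl.
  assert (0 <= (2 + y) * exp (- y)).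
    apply Rmult_le_pos; [lra | apply Rlt_le, exp_pos].
  assert ((2 + x) * exp (- x) <= 2); [| lra].
  assert (e : exp x * exp (- x) = 1) by now rewrite <- exp_plus, Rplus_opp_r, exp_0.
  generalize (exp_ineq1_le x) (exp_pos (- x)); nra.
Qed.

(* The integrand is positive, so the improper integral is the supremum of its
   proper sub-integrals. *)
Lemma Gamma_pos (p : R) : 0 < p < 1 -> 0 < Gamma (p + 1).
Proof.
intros hp.
destruct (completeness (fun v => exists x y, 0 < x <= y /\ v = RInt (gamma_fun p) x y))
  as [l [ub lub]].
- exists 2; intros v [x [y [hxy ->]]]; now apply RInt_gamma_fun_le.
- exists (RInt (gamma_fun p) 1 2), 1, 2; split; [lra | trivial].
- assert (lpos : 0 < l).
    apply Rlt_le_trans with (RInt (gamma_fun p) 1 2).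
    + apply RInt_gt_0; [lra | intros; apply gamma_fun_pos |].
      intros; apply gamma_fun_cont; lra.
    + apply ub; exists 1, 2; split; [lra | trivial].
  assert (h : is_RInt_gen (gamma_fun p) (at_right 0) (Rbar_locally p_infty) l).
    apply filterlimi_locally; intros eps.
    assert (near : exists x y, 0 < x <= y /\ l - eps < RInt (gamma_fun p) x y).
      destruct (Classical_Prop.classic
        (exists x y, 0 < x <= y /\ l - eps < RInt (gamma_fun p) x y)) as [|no]; trivial.
      exfalso; assert (l <= l - eps); [| generalize (cond_pos eps); lra].
      apply lub; intros v [x [y [hxy ->]]].
      apply Rnot_lt_le; intros hlt; apply no; exists x, y; auto.
    destruct near as [x [y [hxy hl]]].
    (* Over any larger interval the integral stays between [l - eps] and [l]. *)
    apply (Filter_prod _ _ _ (fun u => 0 < u < x) (fun v => y < v)).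
    + exists (mkposreal x (proj1 hxy)); intros u hu u0.
      split; trivial.
      unfold ball in hu; simpl in hu; unfold AbsRing_ball, abs, minus, plus, opp in hu; simpl in hu.
      apply Rabs_def2 in hu; lra.
    + exists y; auto.
    + intros u v hu hv; simpl.
      exists (RInt (gamma_fun p) u v); split.
        apply (RInt_correct (gamma_fun p)), gamma_fun_ex_RInt; lra.
      assert (RInt (gamma_fun p) u v <= l) by (apply ub; exists u, v; split; [lra | trivial]).
      assert (RInt (gamma_fun p) x y <= RInt (gamma_fun p) u v).
        rewrite <- (RInt_Chasles (gamma_fun p) u x v), <- (RInt_Chasles (gamma_fun p) x y v);
          try (apply gamma_fun_ex_RInt; lra).
        unfold plus; simpl.
        assert (pos : forall a b, 0 < a <= b -> 0 <= RInt (gamma_fun p) a b).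
          intros a b hab; apply RInt_ge_0; [lra | apply gamma_fun_ex_RInt; lra |].
          intros t _; apply Rlt_le, gamma_fun_pos.
        generalize (pos u x) (pos y v); lra.
      unfold ball; simpl; unfold AbsRing_ball, abs, minus, plus, opp; simpl.
      apply Rabs_def1; lra.
  unfold Gamma; replace (p + 1 - 1) with p by ring.
  change (0 < RInt_gen (gamma_fun p) (at_right 0) (Rbar_locally p_infty)).
  now rewrite (is_RInt_gen_unique _ _ h).
Qed.

(** * Slopes and trapezoidal errors of a power function *)

Lemma rpow_pos x p : 0 < x -> rpow x p = Rpower x p.
Proof. unfold rpow; destruct (Rlt_dec 0 x); tauto. Qed.

Lemma rpow_0 p : rpow 0 p = 0.
Proof. unfold rpow; destruct (Rlt_dec 0 0); lra. Qed.

Lemma is_derive_Rpower p x : 0 < x -> is_derive (fun x => Rpower x p) x (p * Rpower x (p - 1)).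
Proof.
intros x0; apply is_derive_Reals, derivable_pt_lim_power; trivial.
Qed.

Lemma Rpower_succ x p : 0 < x -> Rpower x (p + 1) = x * Rpower x p.
Proof. intros x0; rewrite Rpower_plus, Rpower_1; trivial; ring. Qed.

Lemma Rpower_le_neg p x y : p <= 0 -> 0 < x <= y -> Rpower y p <= Rpower x p.
Proof.
intros p0 hxy; replace p with (- - p) by ring; rewrite !(Rpower_Ropp _ (- p)).
apply Rinv_le_contravar; [apply exp_pos | apply Rle_Rpower_l; lra].
Qed.

Definition slope (p x y : R) : R := (rpow y p - rpow x p) / (y - x).

(* Twice the error of the trapezoidal rule for [t^p] on [x, y]. *)
Definition trap_err (p x y : R) : R :=
  2 / (p + 1) * (rpow y (p + 1) - rpow x (p + 1)) - (y - x) * (rpow x p + rpow y p).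

(** As a function of its upper end, the error vanishes at x together with its first derivative, and
    its second derivative is p (1 - p) t^(p-2) (t - x). Bounding t^(p-2) by x^(p-2) and integrating
    twice gives both sides. *)
Lemma trap_err_bounds p x y : 0 < p < 1 -> 0 < x <= y ->
  0 <= trap_err p x y <= p * (1 - p) * Rpower x (p - 2) * (y - x) ^ 3 / 6.
Proof.
intros hp hxy; unfold trap_err; rewrite !rpow_pos by lra.
pose (e := fun t => 2 / (p + 1) * (Rpower t (p + 1) - Rpower x (p + 1))
                    - (t - x) * (Rpower x p + Rpower t p)).
pose (e1 := fun t => Rpower t p - Rpower x p - (t - x) * (p * Rpower t (p - 1))).
pose (e2 := fun t => (t - x) * (p * (1 - p) * Rpower t (p - 2))).
assert (de : forall t, x <= t -> is_derive e t (e1 t)).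
  intros t ht; unfold e, e1.
  evar_last.
    apply (is_derive_minus (fun t => 2 / (p + 1) * (Rpower t (p + 1) - Rpower x (p + 1)))
      (fun t => (t - x) * (Rpower x p + Rpower t p))).
      apply is_derive_scal, (is_derive_minus (fun t => Rpower t (p + 1)) (fun _ => Rpower x (p + 1))).
        apply is_derive_Rpower; lra.
      apply is_derive_const.
    apply (is_derive_mult (fun t => t - x) (fun t => Rpower x p + Rpower t p)).
        apply (is_derive_minus (fun t => t) (fun _ => x)); [apply is_derive_id | apply is_derive_const].
      apply (is_derive_plus (fun _ => Rpower x p) (fun t => Rpower t p)).
        apply is_derive_const.
      apply is_derive_Rpower; lra.
    intros; apply Rmult_comm.
  unfold minus, plus, opp, mult, zero, one; simpl.
  replace (p + 1 - 1) with p by ring.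
  unfold mult, one; simpl; field; lra.
assert (de1 : forall t, x <= t -> is_derive e1 t (e2 t)).
  intros t ht; unfold e1, e2.
  evar_last.
    apply (is_derive_minus (fun t => Rpower t p - Rpower x p)
      (fun t => (t - x) * (p * Rpower t (p - 1)))).
      apply (is_derive_minus (fun t => Rpower t p) (fun _ => Rpower x p)).
        apply is_derive_Rpower; lra.
      apply is_derive_const.
    apply (is_derive_mult (fun t => t - x) (fun t => p * Rpower t (p - 1))).
        apply (is_derive_minus (fun t => t) (fun _ => x)); [apply is_derive_id | apply is_derive_const].
      apply is_derive_scal, is_derive_Rpower; lra.
    intros; apply Rmult_comm.
  unfold minus, plus, opp, mult, zero, one; simpl.
  replace (p - 1 - 1) with (p - 2) by ring.
  unfold mult, one; simpl; field; lra.
assert (ex : e x = 0) by (unfold e; ring).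
assert (e1x : e1 x = 0) by (unfold e1; ring).
assert (pq : 0 < p * (1 - p)) by nra.
pose (K := p * (1 - p) * Rpower x (p - 2)).
assert (he2 : forall t, x <= t -> 0 <= e2 t <= K * (t - x)).
  intros t ht; unfold e2, K.
  assert (0 < Rpower t (p - 2)) by apply exp_pos.
  assert (Rpower t (p - 2) <= Rpower x (p - 2)) by (apply Rpower_le_neg; lra).
  assert (p * (1 - p) * Rpower t (p - 2) <= p * (1 - p) * Rpower x (p - 2)) by nra.
  assert (0 <= p * (1 - p) * Rpower t (p - 2)) by nra.
  nra.
assert (dq : forall t, is_derive (fun t => K * (t - x) ^ 2 / 2) t (K * (t - x))).
  intros t; auto_derive; trivial; field.
assert (dc : forall t, is_derive (fun t => K * (t - x) ^ 3 / 6) t (K * (t - x) ^ 2 / 2)).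
  intros t; auto_derive; trivial; field.
assert (d0 : forall t : R, is_derive (fun _ => 0) t 0) by (intros; auto_derive; trivial).
assert (he1 : forall t, x <= t -> 0 <= e1 t <= K * (t - x) ^ 2 / 2).
  intros t ht; split.
  - apply (le_of_derive_le (fun _ => 0) e1 (fun _ => 0) e2 x t); trivial; [| | lra].
    + intros; apply de1; lra.
    + intros; apply he2; lra.
  - apply (le_of_derive_le e1 (fun t => K * (t - x) ^ 2 / 2) e2 (fun t => K * (t - x)) x t);
      trivial; [| | rewrite e1x; lra].
    + intros; apply de1; lra.
    + intros; apply he2; lra.
change (0 <= e y <= K * (y - x) ^ 3 / 6); split.
- apply (le_of_derive_le (fun _ => 0) e (fun _ => 0) e1 x y); [lra | auto | | | lra].
  + intros; apply de; lra.
  + intros; apply he1; lra.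
- apply (le_of_derive_le e (fun t => K * (t - x) ^ 3 / 6) e1 (fun t => K * (t - x) ^ 2 / 2) x y);
    [lra | | auto | | rewrite ex; lra].
  + intros; apply de; lra.
  + intros; apply he1; lra.
Qed.

(** The general bound blows up as x tends to 0, so the interval touching 0 calls for the exact
    value. *)
Lemma trap_err_0 p y : 0 < p -> 0 < y -> trap_err p 0 y = (1 - p) / (p + 1) * Rpower y (p + 1).
Proof.
intros p0 y0; unfold trap_err; rewrite !rpow_0, !rpow_pos, Rpower_succ by lra.
field; lra.
Qed.

Lemma slope_0 p y : 0 < y -> slope p 0 y = Rpower y (p - 1).
Proof.
intros y0; unfold slope; rewrite rpow_0, rpow_pos by trivial.
replace (Rpower y p) with (y * Rpower y (p - 1)); [field; lra |].
rewrite <- Rpower_succ by trivial; f_equal; ring.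
Qed.

Lemma slope_bounds p x y : 0 < p < 1 -> 0 < x < y ->
  p * Rpower y (p - 1) <= slope p x y <= p * Rpower x (p - 1).
Proof.
intros hp hxy; unfold slope; rewrite !rpow_pos by lra.
destruct (MVT_gen (fun t => Rpower t p) x y (fun t => p * Rpower t (p - 1))) as [c [hc e]];
  rewrite Rmin_left, Rmax_right in * by lra.
- intros t ht; apply is_derive_Rpower; lra.
- intros t ht; apply continuity_pt_filterlim, (ex_derive_continuous (fun t => Rpower t p)).
  eexists; apply is_derive_Rpower; lra.
- cbv beta in e; rewrite e.
  replace (p * Rpower c (p - 1) * (y - x) / (y - x)) with (p * Rpower c (p - 1)) by (field; lra).
  split; apply Rmult_le_compat_l; try lra; apply Rpower_le_neg; lra.
Qed.

(** On (0, y] the second derivative of t^p is at most -K, so t^p + K t^2 / 2 is still concave and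
    its slopes decrease. The quadratic part alone changes the slope by K (y - x) / 2. *)
Lemma slope_diff_ge p x m y : 0 < p < 1 -> 0 < x < m -> m < y ->
  p * (1 - p) * Rpower y (p - 2) * (y - x) / 2 <= slope p x m - slope p m y.
Proof.
intros hp hxm hmy; unfold slope; rewrite !rpow_pos by lra.
pose (K := p * (1 - p) * Rpower y (p - 2)).
pose (g := fun t => Rpower t p + K / 2 * t ^ 2).
pose (g1 := fun t => p * Rpower t (p - 1) + K * t).
assert (dg : forall t, 0 < t -> is_derive g t (g1 t)).
  intros t t0; unfold g, g1.
  apply (is_derive_plus (fun t => Rpower t p) (fun t => K / 2 * t ^ 2)).
    now apply is_derive_Rpower.
  auto_derive; trivial; field.
assert (anti : forall u v, 0 < u -> u <= v <= y -> g1 v <= g1 u).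
  intros u v u0 huv.
  apply (le_of_derive_le g1 (fun _ => g1 u)
    (fun t => p * ((p - 1) * Rpower t (p - 1 - 1)) + K) (fun _ => 0) u v); try lra.
  - intros t ht; apply (is_derive_plus (fun t => p * Rpower t (p - 1)) (fun t => K * t)).
      apply is_derive_scal, is_derive_Rpower; lra.
    auto_derive; trivial; ring.
  - intros; apply (is_derive_const (g1 u)).
  - intros t ht; unfold K; replace (p - 1 - 1) with (p - 2) by ring.
    assert (Rpower y (p - 2) <= Rpower t (p - 2)) by (apply Rpower_le_neg; lra).
    assert (0 < p * (1 - p)) by nra; nra.
assert (mvt : forall u v, 0 < u < v -> exists c, u <= c <= v /\ (g v - g u) / (v - u) = g1 c).
  intros u v huv.
  destruct (MVT_gen g u v g1) as [c [hc e]]; rewrite Rmin_left, Rmax_right in * by lra.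
  - intros t ht; apply dg; lra.
  - intros t ht; apply continuity_pt_filterlim, (ex_derive_continuous g).
    exists (g1 t); apply dg; lra.
  - exists c; split; trivial; rewrite e; field; lra.
destruct (mvt x m) as [c1 [hc1 s1]]; [lra |].
destruct (mvt m y) as [c2 [hc2 s2]]; [lra |].
assert (h : g1 c2 <= g1 c1) by (apply anti; lra).
replace ((Rpower m p - Rpower x p) / (m - x)) with (g1 c1 - K / 2 * (m + x)).
  replace ((Rpower y p - Rpower m p) / (y - m)) with (g1 c2 - K / 2 * (y + m)).
    fold K; lra.
  rewrite <- s2; unfold g; field; lra.
rewrite <- s1; unfold g; field; lra.
Qed.

(** Moves negative powers to a common base point at the price of a numerical constant. *)
Lemma Rpower_ratio_le (k c e x y : R) : 0 <= e -> 0 < k -> Rpower k e <= c ->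
  0 < x -> 0 < y <= k * x -> Rpower x (- e) <= c * Rpower y (- e).
Proof.
intros e0 k0 hc x0 hy.
apply Rle_trans with (c * Rpower (k * x) (- e)).
- rewrite <- Rpower_mult_distr by trivial.
  rewrite (Rpower_Ropp k).
  assert (0 < Rpower k e) by apply exp_pos.
  assert (0 < Rpower x (- e)) by apply exp_pos.
  apply Rle_trans with (Rpower k e * (/ Rpower k e * Rpower x (- e))).
    right; field; lra.
  apply Rmult_le_compat_r; trivial.
  apply Rmult_le_pos; [apply Rlt_le, Rinv_0_lt_compat | ]; lra.
- apply Rmult_le_compat_l.
    apply Rle_trans with (2 := hc), Rlt_le, exp_pos.
  apply Rpower_le_neg; lra.
Qed.

(** For the grid, x, y, z are s_i, s_{i-1}, s_{i-2}, and the divisor is log (t_i / t_{i-2}). *)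
Definition beta (p x y z : R) : R := trap_err p x y / (z - x).

Lemma beta_ge_0 p x y z : 0 < p < 1 -> 0 <= x < y -> y < z -> 0 <= beta p x y z.
Proof.
intros hp hxy hz; unfold beta; apply Rdiv_le_0_compat; [| lra].
destruct (Rle_lt_or_eq_dec 0 x) as [x0 | <-]; [lra | apply trap_err_bounds; lra |].
rewrite trap_err_0 by lra; apply Rmult_le_pos; [| apply Rlt_le, exp_pos].
apply Rdiv_le_0_compat; lra.
Qed.

(** The divisors [z - x] and [d] absorb two of the three factors [y - x] of the trapezoidal bound;
    the 2 turns its 6 into 12. *)
Lemma beta_div_le p x y z d : 0 < p < 1 -> 0 < x < y -> 2 * (y - x) <= z - x -> y - x <= d ->
  beta p x y z / d <= p * (1 - p) * Rpower x (p - 2) * (y - x) / 12.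
Proof.
intros hp hxy hz hd; unfold beta.
destruct (trap_err_bounds p x y hp) as [_ h]; [lra |].
set (K := p * (1 - p) * Rpower x (p - 2)) in *.
assert (0 <= K).
  unfold K; generalize (exp_pos ((p - 2) * ln x)); fold (Rpower x (p - 2)).
  assert (0 < p * (1 - p)) by nra; nra.
apply Rle_div_l; [lra |]; apply Rle_div_l; [lra |].
apply Rle_trans with (1 := h).
assert (2 * (y - x) * (y - x) <= (z - x) * d) by nra.
replace (K * (y - x) ^ 3 / 6) with (K * (y - x) / 12 * (2 * (y - x) * (y - x))) by field.
replace (K * (y - x) / 12 * d * (z - x)) with (K * (y - x) / 12 * ((z - x) * d)) by ring.
apply Rmult_le_compat_l; trivial; apply Rdiv_le_0_compat; [nra | lra].
Qed.

(** All powers are compared with x3^(p-2). For nearly equal steps the corrections then cost 9 + 2.25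
    = 11.25 steps, against the 12 supplied by [slope_diff_ge]. *)
Lemma slope_step_interior p x0 x1 x2 x3 (zterm : R) : 1 / 2 < p < 1 ->
  0 < x0 < x1 -> x1 < x2 < x3 ->
  x1 - x0 <= 1.01 * x0 ->
  x1 - x0 <= x2 - x1 <= 1.01 * (x1 - x0) ->
  x2 - x1 <= x3 - x2 <= 1.01 * (x2 - x1) ->
  zterm <= p * (1 - p) * Rpower x2 (p - 2) * (x3 - x2) / 12 ->
  beta p x0 x1 x2 / (x2 - x1) + zterm <= slope p x1 x2 - slope p x2 x3.
Proof.
intros hp h01 h13 hx hd1 hd2 hz.
apply Rle_trans with (2 := slope_diff_ge p x1 x2 x3 ltac:(lra) ltac:(lra) ltac:(lra)).
generalize (beta_div_le p x0 x1 x2 (x2 - x1) ltac:(lra) ltac:(lra) ltac:(lra) ltac:(lra)).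
assert (r0 : Rpower x0 (p - 2) <= 9 * Rpower x3 (p - 2)).
  replace (p - 2) with (- (2 - p)) by ring.
  (* x3 / x0 <= 1 + 1.01 + 1.01^2 + 1.01^3 < 4.1, and the exponent 2 - p is below 3/2. *)
  apply (Rpower_ratio_le 4.1); try lra.
  apply Rle_trans with (Rpower 4.1 (/ 2 + 1)); [apply Rle_Rpower; lra |].
  rewrite Rpower_succ, Rpower_sqrt by lra.
  assert (sqrt 4.1 <= sqrt (2.1 * 2.1)) by (apply sqrt_le_1_alt; lra).
  rewrite sqrt_square in H by lra; lra.
assert (r2 : Rpower x2 (p - 2) <= 2.25 * Rpower x3 (p - 2)).
  replace (p - 2) with (- (2 - p)) by ring.
  (* The ratio x3 / x2 is at most about 4/3, and 2 - p < 2. *)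
  apply (Rpower_ratio_le 1.5); try lra.
  apply Rle_trans with (Rpower 1.5 (1 + 1)); [apply Rle_Rpower; lra |].
  rewrite Rpower_succ, Rpower_1; lra.
assert (0 < Rpower x3 (p - 2)) by apply exp_pos.
assert (pq : 0 < p * (1 - p)) by nra.
revert hz r0 r2 H; generalize (Rpower x0 (p - 2)) (Rpower x2 (p - 2)) (Rpower x3 (p - 2)).
intros X0 X2 X3 hz r0 r2 X3p hb.
apply Rle_trans with (p * (1 - p) * (X0 * (x1 - x0) / 12 + X2 * (x3 - x2) / 12)); [lra |].
replace (p * (1 - p) * X3 * (x3 - x1) / 2) with (p * (1 - p) * (X3 * (x3 - x1) / 2)) by field.
apply Rmult_le_compat_l; [lra |].
assert (X0 * (x1 - x0) <= 9 * X3 * (x1 - x0)) by (apply Rmult_le_compat_r; lra).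
assert (X2 * (x3 - x2) <= 2.25 * X3 * (x3 - x2)) by (apply Rmult_le_compat_r; lra).
assert (X3 * (9 * (x1 - x0) + 2.25 * (x3 - x2)) <= X3 * (6 * (x3 - x1))) by (apply Rmult_le_compat_l; lra).
lra.
Qed.

(** The slope from 0 is u^(p-1) while the next one is at most p u^(p-1); the gap (1 - p) u^(p-1)
    covers the correction. *)
Lemma slope_step_last p u v (zterm : R) : 0 < p < 1 -> 0 < u < v -> v - u <= 2 * u ->
  zterm <= p * (1 - p) * Rpower u (p - 2) * (v - u) / 12 ->
  zterm <= slope p 0 u - slope p u v.
Proof.
intros hp huv hd hz; apply Rle_trans with (1 := hz).
rewrite slope_0 by lra.
destruct (slope_bounds p u v hp huv) as [_ h].
assert (e : Rpower u (p - 1) = u * Rpower u (p - 2)).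
  rewrite <- Rpower_succ by lra; f_equal; ring.
rewrite e in *.
assert (0 < Rpower u (p - 2)) by apply exp_pos.
generalize dependent (Rpower u (p - 2)); intros X hz h e X0.
apply Rle_trans with ((1 - p) * (u * X)); [| lra].
replace (p * (1 - p) * X * (v - u) / 12) with ((1 - p) * (p * X * (v - u) / 12)) by field.
apply Rmult_le_compat_l; [lra |].
assert (p * (v - u) <= 1 * (2 * u)) by (apply Rmult_le_compat; lra).
nra.
Qed.

(** * Homogeneity and the limit of equal steps near the last level *)

Lemma rpow_scale l a q : 0 < l -> 0 <= a -> rpow (l * a) q = Rpower l q * rpow a q.
Proof.
intros l0 a0; destruct (Rle_lt_or_eq_dec 0 a a0) as [ap | <-].
- rewrite !rpow_pos by (try apply Rmult_lt_0_compat; trivial).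
  now rewrite Rpower_mult_distr.
- rewrite Rmult_0_r, rpow_0; ring.
Qed.

Lemma slope_scale p l a b : 0 < l -> 0 <= a < b ->
  slope p (l * a) (l * b) = Rpower l (p - 1) * slope p a b.
Proof.
intros l0 hab; unfold slope; rewrite !rpow_scale by lra.
rewrite <- (Rmult_minus_distr_l l b a).
replace (Rpower l p) with (l * Rpower l (p - 1)).
  field; lra.
rewrite <- Rpower_succ by trivial; f_equal; ring.
Qed.

Lemma trap_err_scale p l a b : 0 < l -> 0 <= a < b ->
  trap_err p (l * a) (l * b) = Rpower l (p + 1) * trap_err p a b.
Proof.
intros l0 hab; unfold trap_err; rewrite !rpow_scale, Rpower_succ by lra; ring.
Qed.

(** A lower bound for Gamma (1 + p) (c_{n-1,n} - c_{n-2,n}), rescaled so that s_{n-1} = 1; x and y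
    are then the two preceding steps. Inverses replace divisions to match the continuity lemmas in
    two variables. *)
Definition near_last_gap (p x y : R) : R :=
  (Rpower (1 + x) p - 1) * / x - (Rpower (1 + x + y) p - Rpower (1 + x) p) * / y
  + (2 / (p + 1) * (Rpower (1 + x) (p + 1) - 1) - x * (1 + Rpower (1 + x) p))
     * / (x + y) * (/ x + / y)
  - (1 - p) / (p + 1) * / (1 + x) * / x
  - (2 / (p + 1) * (Rpower (1 + x + y) (p + 1) - Rpower (1 + x) (p + 1))
      - y * (Rpower (1 + x) p + Rpower (1 + x + y) p)) * / (2 * y * y).

Lemma near_last_gap_1 p : 0 < p -> near_last_gap p 1 1 = thr p / (2 * (p + 1)).
Proof.
intros p0; unfold near_last_gap, thr.
replace (1 + 1 + 1) with 3 by ring; replace (1 + 1) with 2 by ring.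
rewrite !Rpower_succ by lra; field; lra.
Qed.

Lemma continuity_2d_pt_Rpower f q x y : 0 < f x y ->
  continuity_2d_pt f x y -> continuity_2d_pt (fun u v => Rpower (f u v) q) x y.
Proof.
intros pos hf; apply (continuity_1d_2d_pt_comp (fun t => Rpower t q)); trivial.
apply continuity_pt_filterlim, (ex_derive_continuous (fun t => Rpower t q)).
eexists; now apply is_derive_Rpower.
Qed.

Lemma near_last_gap_cont p : continuity_2d_pt (near_last_gap p) 1 1.
Proof.
unfold near_last_gap.
repeat first [ apply continuity_2d_pt_const | apply continuity_2d_pt_id1
  | apply continuity_2d_pt_id2 | apply continuity_2d_pt_minus
  | apply continuity_2d_pt_plus | apply continuity_2d_pt_mult
  | (apply continuity_2d_pt_inv; [| lra])
  | (apply continuity_2d_pt_Rpower; [lra |])].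
Qed.

Lemma near_last_gap_pos p : 0.6262 < p < 1 ->
  exists e, 0 < e /\ forall x y, 1 <= x <= 1 + e -> 1 <= y <= 1 + e -> 0 < near_last_gap p x y.
Proof.
intros hp.
assert (pos : 0 < near_last_gap p 1 1).
  rewrite near_last_gap_1 by lra; apply Rdiv_lt_0_compat; [now apply thr_pos | lra].
destruct (near_last_gap_cont p (mkposreal _ pos)) as [d hd].
exists (d / 2); generalize (cond_pos d); intros d0; split; [lra |].
intros x y hx hy.
assert (h : Rabs (near_last_gap p x y - near_last_gap p 1 1) < near_last_gap p 1 1).
  apply hd; apply Rabs_def1; lra.
apply Rabs_def2 in h; lra.
Qed.

(** * Monotonicity of the weights *)

(** Every term is homogeneous of degree p - 1, so dividing by u^(p-1) leaves [near_last_gap] at the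
    step ratios. The point [v + 2 * (w - v)] is the extreme case in which the next step equals
    [w - v], which makes the correction largest. *)
Lemma slope_step_near_last p e u v w zterm : 0 < p < 1 ->
  (forall x y, 1 <= x <= 1 + e -> 1 <= y <= 1 + e -> 0 < near_last_gap p x y) ->
  0 < u -> u <= v - u <= (1 + e) * u -> u <= w - v <= (1 + e) * u ->
  zterm <= beta p v w (v + 2 * (w - v)) / (w - v) ->
  beta p 0 u v / (v - u) + zterm
    <= slope p u v - slope p v w + beta p u v w / (v - u) + beta p u v w / (w - v).
Proof.
intros hp hgap u0 hv hw hz.
set (x := (v - u) / u); set (y := (w - v) / u).
assert (hx : 1 <= x <= 1 + e).
  unfold x; split; [apply Rle_div_r | apply Rle_div_l]; lra.
assert (hy : 1 <= y <= 1 + e).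
  unfold y; split; [apply Rle_div_r | apply Rle_div_l]; lra.
specialize (hgap x y hx hy).
assert (ev : v = u * (1 + x)) by (unfold x; field; lra).
assert (ew : w = u * (1 + x + y)) by (unfold x, y; field; lra).
cut (slope p u v - slope p v w + beta p u v w / (v - u) + beta p u v w / (w - v)
  - beta p 0 u v / (v - u) - beta p v w (v + 2 * (w - v)) / (w - v)
  = Rpower u (p - 1) * near_last_gap p x y).
  generalize (exp_pos ((p - 1) * ln u)); fold (Rpower u (p - 1)); intros.
  assert (0 < Rpower u (p - 1) * near_last_gap p x y) by now apply Rmult_lt_0_compat.
  lra.
clearbody x y; subst v w.
clear hv hw hz.
replace (slope p u (u * (1 + x))) with (slope p (u * 1) (u * (1 + x))) by (f_equal; ring).
unfold beta.
replace (trap_err p u (u * (1 + x))) with (trap_err p (u * 1) (u * (1 + x))) by (f_equal; ring).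
rewrite trap_err_0, !trap_err_scale, !slope_scale by lra.
(* All powers of [u] are expressed through u^(p-1), so that [field] can close the identity. *)
replace (p + 1) with ((p - 1) + 1 + 1) by ring.
rewrite !(Rpower_succ u) by trivial.
replace ((p - 1) + 1 + 1) with (p + 1) by ring.
unfold slope, trap_err, near_last_gap; rewrite !rpow_pos by lra.
replace (Rpower 1 p) with 1 by (unfold Rpower; rewrite ln_1, Rmult_0_r, exp_0; trivial).
replace (Rpower 1 (p + 1)) with 1 by (unfold Rpower; rewrite ln_1, Rmult_0_r, exp_0; trivial).
generalize (Rpower u (p - 1)) (Rpower (1 + x) p) (Rpower (1 + x + y) p)
  (Rpower (1 + x) (p + 1)) (Rpower (1 + x + y) (p + 1)); intros K X1 X2 X3 X4.
replace (u * (1 + x) - u) with (u * x) by ring.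
replace (u * (1 + x + y) - u * (1 + x)) with (u * y) by ring.
replace (u * (1 + x + y) - u) with (u * (x + y)) by ring.
replace (u * (1 + x) + 2 * (u * y) - u * (1 + x)) with (u * (2 * y)) by ring.
replace (1 + x - 1) with x by ring.
replace (1 + x + y - (1 + x)) with y by ring.
rewrite Rminus_0_r.
field; repeat split; lra.
Qed.

(** Abstracts the properties of s_i = log (t_n / t_i) from which the bounds on the weights are
    derived. *)
Definition graded (e : R) (s : nat -> R) (n : nat) : Prop :=
  s n = 0 /\ (forall i, (i < n)%nat -> 0 < s i - s (S i)) /\
  (forall i, (S i < n)%nat ->
     s (S i) - s (S (S i)) <= s i - s (S i) <= (1 + e) * (s (S i) - s (S (S i)))).

Lemma graded_pos e s n i : graded e s n -> (i < n)%nat -> 0 < s i.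
Proof.
intros [s0 [pos _]] hi.
assert (h : forall m, (m <= n)%nat -> 0 <= s (n - m)%nat).
  induction m as [|m IH]; intros hm.
    rewrite Nat.sub_0_r; lra.
  specialize (IH ltac:(lia)); specialize (pos (n - S m)%nat ltac:(lia)).
  replace (S (n - S m)) with (n - m)%nat in pos by lia; lra.
specialize (h (n - S i)%nat ltac:(lia)).
replace (n - (n - S i))%nat with (S i) in h by lia.
specialize (pos i hi); lra.
Qed.

(* [l12_coef p s n k] is [Gamma (1 + p) * c_{k+1,n}] when [s i = log (t_n / t_i)]
   and [p = 1 - alpha]; note [beta] is minus the coefficient [b] of the scheme. *)
Definition l12_coef (p : R) (s : nat -> R) (n k : nat) : R :=
  slope p (s (S k)) (s k)
  + (match k with O => 0 | S j => beta p (s (S k)) (s k) (s j) end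
     - (if (S k <? n)%nat then beta p (s (S (S k))) (s (S k)) (s k) else 0))
    / (s k - s (S k)).

Lemma l12_coef_incr p : 0.6262 < p < 1 ->
  exists e, 0 < e /\ forall s n, graded e s n ->
    forall k, (S k < n)%nat -> l12_coef p s n k <= l12_coef p s n (S k).
Proof.
intros hp; destruct (near_last_gap_pos p hp) as [e0 [e0pos hgap]].
(* 0.01 serves the interior levels; e0 / 3 ensures (1 + e)^2 <= 1 + e0, since the ratio of two steps
   that are two levels apart enters near the end. *)
exists (Rmin 0.01 (e0 / 3)).
assert (el : Rmin 0.01 (e0 / 3) <= 0.01) by apply Rmin_l.
assert (er : Rmin 0.01 (e0 / 3) <= e0 / 3) by apply Rmin_r.
assert (ep : 0 < Rmin 0.01 (e0 / 3)) by (apply Rmin_glb_lt; lra).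
set (e := Rmin 0.01 (e0 / 3)) in *; clearbody e.
split; trivial; intros s n hs k hk.
pose proof (fun i => graded_pos e s n i hs) as spos.
destruct hs as [sn [step ratio]].
(* This is the only contribution of s_{k-1}; the bound [hz] also covers k = 0, where it is
   absent. *)
set (zterm := match k with O => 0 | S j => beta p (s (S k)) (s k) (s j) end / (s k - s (S k))).
assert (hz : zterm <= beta p (s (S k)) (s k) (s (S k) + 2 * (s k - s (S k))) / (s k - s (S k))).
  assert (0 < s k - s (S k)) by (apply step; lia).
  assert (0 < s (S k)) by (apply spos; lia).
  assert (0 <= trap_err p (s (S k)) (s k)) by (apply trap_err_bounds; lra).
  unfold zterm; apply Rmult_le_compat_r; [now apply Rlt_le, Rinv_0_lt_compat |].
  destruct k as [|j]; [apply beta_ge_0; lra |].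
  unfold beta; apply Rmult_le_compat_l; trivial.
  apply Rinv_le_contravar; [lra |].
  specialize (ratio j ltac:(lia)); lra.
assert (l0 : 0 < s k - s (S k)) by (apply step; lia).
assert (l1 : 0 < s (S k) - s (S (S k))) by (apply step; lia).
pose proof (ratio k ltac:(lia)) as r0.
pose proof (spos (S k) ltac:(lia)) as pk1.
assert (hzc : zterm <= p * (1 - p) * Rpower (s (S k)) (p - 2) * (s k - s (S k)) / 12).
  apply Rle_trans with (1 := hz); apply beta_div_le; lra.
unfold l12_coef.
replace (S k <? n)%nat with true by (symmetry; apply Nat.ltb_lt; lia).
unfold Rdiv; rewrite (Rmult_minus_distr_r _ _ (/ (s k - s (S k)))).
fold (match k with O => 0 | S j => beta p (s (S k)) (s k) (s j) end / (s k - s (S k))).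
fold zterm; rewrite Rmult_minus_distr_r.
clearbody zterm.
destruct (Nat.eq_dec (S (S k)) n) as [last | notlast].
(* Comparison of c_{n-1,n} with c_{n,n}. *)
- replace (S (S k) <? n)%nat with false by (symmetry; apply Nat.ltb_ge; lia).
  assert (s2 : s (S (S k)) = 0) by (rewrite last; trivial).
  assert (0 <= beta p (s (S (S k))) (s (S k)) (s k)) by (apply beta_ge_0; lra).
  assert (0 < / (s k - s (S k))) by now apply Rinv_0_lt_compat.
  assert (0 < / (s (S k) - s (S (S k)))) by now apply Rinv_0_lt_compat.
  rewrite s2 in *.
  assert (zterm <= slope p 0 (s (S k)) - slope p (s (S k)) (s k)) by (apply slope_step_last; nra).
  nra.
- replace (S (S k) <? n)%nat with true by (symmetry; apply Nat.ltb_lt; lia).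
  pose proof (ratio (S k) ltac:(lia)) as r1.
  pose proof (spos (S (S k)) ltac:(lia)) as pk2.
  pose proof (step (S (S k)) ltac:(lia)) as l2.
  destruct (Nat.eq_dec (S (S (S k))) n) as [last | notlast2].
  (* Comparison of c_{n-2,n} with c_{n-1,n}, the critical case for alpha. *)
  + assert (s3 : s (S (S (S k))) = 0) by (rewrite last; trivial).
    rewrite s3 in *.
    assert (h := slope_step_near_last p e0 (s (S (S k))) (s (S k)) (s k) zterm
      ltac:(lra) hgap pk2 ltac:(nra) ltac:(nra) hz).
    unfold Rdiv in h; lra.
  + pose proof (ratio (S (S k)) ltac:(lia)) as r2.
    pose proof (spos (S (S (S k))) ltac:(lia)) as pk3.
    assert (0 <= s (S (S (S (S k))))).
      destruct (Nat.eq_dec (S (S (S (S k)))) n) as [-> |]; [lra |].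
      apply Rlt_le, spos; lia.
    assert (h := slope_step_interior p (s (S (S (S k)))) (s (S (S k))) (s (S k)) (s k) zterm
      ltac:(lra) ltac:(lra) ltac:(lra) ltac:(nra) ltac:(nra) ltac:(nra) hzc).
    assert (0 <= beta p (s (S (S k))) (s (S k)) (s k)) by (apply beta_ge_0; lra).
    assert (0 < / (s k - s (S k))) by now apply Rinv_0_lt_compat.
    assert (0 < / (s (S k) - s (S (S k)))) by now apply Rinv_0_lt_compat.
    unfold Rdiv in h; nra.
Qed.

(** For n >= 2 the slope is at least p s_0^(p-1) and the correction at most 0.3 s_0^(p-1), and p -
    0.3 > (1 - p) / 3 in this range of p. *)
Lemma l12_coef_first_ge p e s n : 0.6262 < p < 1 -> e <= 0.01 -> graded e s n -> (0 < n)%nat ->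
  (1 - p) / 3 * Rpower (s O) (p - 1) <= l12_coef p s n 0.
Proof.
intros hp he hs hn.
pose proof (fun i => graded_pos e s n i hs) as spos.
destruct hs as [sn [step ratio]].
unfold l12_coef.
pose proof (spos 0%nat hn) as p0.
pose proof (step 0%nat hn) as l0.
assert (S0 : 0 < Rpower (s 0%nat) (p - 1)) by apply exp_pos.
destruct (Nat.eq_dec n 1) as [-> | n1].
- rewrite sn, slope_0 by trivial; simpl.
  unfold Rdiv; rewrite Rminus_0_r, Rmult_0_l; nra.
- replace (1 <? n)%nat with true by (symmetry; apply Nat.ltb_lt; lia).
  pose proof (spos 1%nat ltac:(lia)) as p1.
  pose proof (step 1%nat ltac:(lia)) as l1.
  pose proof (ratio 0%nat ltac:(lia)) as r0.
  destruct (slope_bounds p (s 1%nat) (s 0%nat)) as [sl _]; [lra | lra |].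
  cut (beta p (s 2%nat) (s 1%nat) (s 0%nat) / (s 0%nat - s 1%nat) <= 0.3 * Rpower (s 0%nat) (p - 1)).
    unfold Rdiv; rewrite Rminus_0_l, <- Ropp_mult_distr_l; nra.
  destruct (Nat.eq_dec n 2) as [-> | n2].
  + rewrite sn in *; unfold beta; rewrite trap_err_0, Rpower_succ by lra.
    assert (r : Rpower (s 1%nat) (p - 1) <= 2 * Rpower (s 0%nat) (p - 1)).
      replace (p - 1) with (- (1 - p)) by ring.
      (* Here s_0 <= 2.01 s_1; the generous ratio 4 makes the constant 4^(1/2) = 2. *)
      apply (Rpower_ratio_le 4); try lra; [| nra].
      apply Rle_trans with (Rpower 4 (/ 2)); [apply Rle_Rpower; lra |].
      rewrite Rpower_sqrt, <- (sqrt_square 2) by lra; apply sqrt_le_1_alt; lra.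
    replace (Rpower (s 1%nat) p) with (s 1%nat * Rpower (s 1%nat) (p - 1))
      by (rewrite <- Rpower_succ by trivial; f_equal; ring).
    apply Rle_div_l; [lra |]; apply Rle_div_l; [lra |].
    (* The quotient decreases in p and is just below 0.23 at p = 0.6262. *)
    assert (q : (1 - p) / (p + 1) <= 0.23) by (apply Rle_div_l; lra).
    assert (q0 : 0 <= (1 - p) / (p + 1)) by (apply Rdiv_le_0_compat; lra).
    generalize dependent ((1 - p) / (p + 1)); intros c q q0.
    assert (X1p : 0 < Rpower (s 1%nat) (p - 1)) by apply exp_pos.
    generalize dependent (Rpower (s 1%nat) (p - 1)).
    generalize dependent (Rpower (s 0%nat) (p - 1)); intros X0 X0p _ X1 hX X1p.
    assert (s 1%nat * (2 * s 1%nat) <= (s 0%nat - s 1%nat) * (s 0%nat - 0)) by nra.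
    apply Rle_trans with (0.23 * (s 1%nat * (s 1%nat * (2 * X0)))).
      apply Rmult_le_compat; trivial.
        repeat apply Rmult_le_pos; lra.
      repeat (apply Rmult_le_compat_l; [lra |]); trivial.
    assert (X0 * (s 1%nat * (2 * s 1%nat)) <= X0 * ((s 0%nat - s 1%nat) * (s 0%nat - 0)))
      by (apply Rmult_le_compat_l; lra).
    nra.
  + pose proof (ratio 1%nat ltac:(lia)) as r1.
    pose proof (spos 2%nat ltac:(lia)) as p2.
    pose proof (step 2%nat ltac:(lia)) as l2.
    assert (h3 : 0 <= s 3%nat).
      destruct (Nat.eq_dec n 3) as [-> |]; [lra | apply Rlt_le, spos; lia].
    apply Rle_trans with (1 := beta_div_le p (s 2%nat) (s 1%nat) (s 0%nat) (s 0%nat - s 1%nat) ltac:(lra) ltac:(lra)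
      ltac:(lra) ltac:(lra)).
    assert (s1b : s 1%nat - s 2%nat <= 1.01 * s 2%nat) by nra.
    assert (r : Rpower (s 2%nat) (p - 1) <= 2 * Rpower (s 0%nat) (p - 1)).
      replace (p - 1) with (- (1 - p)) by ring.
      apply (Rpower_ratio_le 4); try lra; [| nra].
      apply Rle_trans with (Rpower 4 (/ 2)); [apply Rle_Rpower; lra |].
      rewrite Rpower_sqrt, <- (sqrt_square 2) by lra; apply sqrt_le_1_alt; lra.
    replace (Rpower (s 2%nat) (p - 1)) with (s 2%nat * Rpower (s 2%nat) (p - 2)) in r
      by (rewrite <- Rpower_succ by trivial; f_equal; ring).
    assert (0 < Rpower (s 2%nat) (p - 2)) by apply exp_pos.
    generalize dependent (Rpower (s 2%nat) (p - 2)); intros X2 r X2p.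
    generalize dependent (Rpower (s 0%nat) (p - 1)); intros X0 X0p _ r.
    assert (X2 * (s 1%nat - s 2%nat) <= X2 * (1.01 * s 2%nat)) by (apply Rmult_le_compat_l; nra).
    assert (pq : 0 <= p * (1 - p) <= 1) by nra.
    apply Rle_trans with (1 * (X2 * (s 1%nat - s 2%nat)) / 12); [| lra].
    apply Rmult_le_compat_r; [lra |]; rewrite Rmult_assoc.
    apply Rmult_le_compat_r; nra.
Qed.

(** * The logarithmic grid *)

Lemma ln_le_sub_1 x : 0 < x -> ln x <= x - 1.
Proof. intros x0; generalize (exp_ineq1_le (ln x)); rewrite exp_ln by trivial; lra. Qed.

Lemma tau_pos at0 T N : at0 < T -> (0 < N)%nat -> 0 < tau at0 T N.
Proof. intros hT hN; apply Rdiv_lt_0_compat; [lra | now apply lt_0_INR]. Qed.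

Section Grid.
Variables (al at0 T : R) (N : nat).
Hypotheses (at0_pos : 0 < at0) (tau0 : 0 < tau at0 T N).

Let t := tk at0 T N.

Lemma tk_S k : t (S k) = t k + tau at0 T N.
Proof. unfold t, tk; rewrite S_INR; ring. Qed.

Lemma tk_0 : t 0%nat = at0.
Proof. unfold t, tk; simpl; ring. Qed.

Lemma tk_ge k : at0 <= t k.
Proof. unfold t, tk; generalize (pos_INR k); nra. Qed.

Lemma Lg_sub n i j : Lg at0 T N n i - Lg at0 T N n j = ln (t j / t i).
Proof.
unfold Lg; fold t; generalize (tk_ge i) (tk_ge j) (tk_ge n); intros.
rewrite !ln_div by lra; ring.
Qed.

(** The ratios t_{i+1} / t_i decrease. By 1 - 1/x <= log x <= x - 1, consecutive steps have ratio at
    most t_{i+2} / t_i = 1 + 2 tau / t_i. *)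
Lemma Lg_graded e n : 0 < e -> 2 * tau at0 T N <= e * at0 -> graded e (Lg at0 T N n) n.
Proof.
intros he htau; repeat split.
- unfold Lg, Rdiv; rewrite Rinv_r, ln_1; trivial.
  generalize (tk_ge n); unfold t; lra.
- intros i hi; rewrite Lg_sub; generalize (tk_ge i); intros.
  rewrite <- ln_1; apply ln_increasing; [lra |].
  apply Rlt_div_r; [lra | rewrite tk_S; lra].
- rewrite !Lg_sub; generalize (tk_ge i); intros.
  apply ln_le.
    rewrite !tk_S; apply Rdiv_lt_0_compat; lra.
  rewrite !tk_S.
  apply Rle_div_l; [lra |].
  replace ((t i + tau at0 T N) / t i * (t i + tau at0 T N))
    with (t i + tau at0 T N + tau at0 T N + tau at0 T N ^ 2 / t i) by (field; lra).
  generalize (Rdiv_le_0_compat (tau at0 T N ^ 2) (t i) (pow2_ge_0 _) ltac:(lra)); lra.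
- rewrite !Lg_sub, !tk_S; generalize (tk_ge i); intros.
  apply Rle_trans with (tau at0 T N / t i).
    assert (pos : 0 < (t i + tau at0 T N) / t i) by (apply Rdiv_lt_0_compat; lra).
    apply Rle_trans with (1 := ln_le_sub_1 _ pos); right; field; lra.
  set (u := tau at0 T N) in *.
  assert (h : u / (t i + u + u) <= ln ((t i + u + u) / (t i + u))).
    assert (h := ln_le_sub_1 ((t i + u) / (t i + u + u)) ltac:(apply Rdiv_lt_0_compat; lra)).
    rewrite ln_div in * by lra.
    replace ((t i + u) / (t i + u + u) - 1) with (- (u / (t i + u + u))) in h by (field; lra).
    lra.
  apply Rle_trans with ((1 + e) * (u / (t i + u + u))); [| apply Rmult_le_compat_l; lra].
  apply Rle_div_l; [lra |].
  replace ((1 + e) * (u / (t i + u + u)) * t i) with ((1 + e) * u * t i / (t i + u + u)) by (field; lra).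
  apply -> Rle_div_r; [| lra].
  assert (e * at0 <= e * t i) by (apply Rmult_le_compat_l; lra).
  assert (0 <= u * (e * t i - 2 * u)) by (apply Rmult_le_pos; lra).
  lra.
Qed.

Lemma acoef_slope n k : (k < n)%nat ->
  acoef al at0 T N (S k) n
  = slope (1 - al) (Lg at0 T N n (S k)) (Lg at0 T N n k) * (Lg at0 T N n k - Lg at0 T N n (S k)).
Proof.
intros hk; unfold acoef, slope.
replace (S k - 1)%nat with k by lia.
assert (0 < Lg at0 T N n k - Lg at0 T N n (S k)); [| field; lra].
rewrite Lg_sub, <- ln_1; generalize (tk_ge k); intros; apply ln_increasing; [lra |].
apply Rlt_div_r; [lra | rewrite tk_S; lra].
Qed.

Lemma bcoef_beta n k : al < 1 ->
  bcoef al at0 T N (S (S k)) n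
  = - beta (1 - al) (Lg at0 T N n (S (S k))) (Lg at0 T N n (S k)) (Lg at0 T N n k).
Proof.
intros hal; unfold bcoef, beta, trap_err.
replace (S (S k) - 1)%nat with (S k) by lia; replace (S (S k) - 2)%nat with k by lia.
fold t; rewrite <- !(Lg_sub n).
replace (1 - al + 1) with (2 - al) by ring.
unfold Rdiv; ring.
Qed.

Lemma ccoef_l12 n k : al < 1 -> 0 < Gamma (2 - al) -> (k < n)%nat ->
  ccoef al at0 T N (S k) n = l12_coef (1 - al) (Lg at0 T N n) n k / Gamma (2 - al).
Proof.
intros hal hG hk.
assert (hl : 0 < Lg at0 T N n k - Lg at0 T N n (S k)).
  rewrite Lg_sub, <- ln_1; generalize (tk_ge k); intros; apply ln_increasing; [lra |].
  apply Rlt_div_r; [lra | rewrite tk_S; lra].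
unfold ccoef, l12_coef; fold t.
destruct (Nat.eqb_spec n 1) as [-> | n1].
  replace k with 0%nat in * by lia; simpl.
  rewrite <- (Lg_sub 1), acoef_slope by lia; field; lra.
destruct (Nat.eqb_spec (S k) 1) as [k1 | k1].
  replace k with 0%nat in * by lia.
  replace (1 <? n)%nat with true by (symmetry; apply Nat.ltb_lt; lia).
  rewrite <- (Lg_sub n), acoef_slope, bcoef_beta by lia || trivial; field; lra.
destruct k as [|k]; [lia |].
destruct (Nat.eqb_spec (S (S k)) n) as [kn | kn].
  replace (S (S k) <? n)%nat with false by (symmetry; apply Nat.ltb_ge; lia).
  rewrite <- kn in *.
  replace (S (S k) - 1)%nat with (S k) by lia.
  rewrite <- (Lg_sub (S (S k))), acoef_slope, bcoef_beta by lia || trivial; field; lra.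
replace (S (S k) <? n)%nat with true by (symmetry; apply Nat.ltb_lt; lia).
replace (S (S k) - 1)%nat with (S k) by lia.
replace (S (S k) + 1)%nat with (S (S (S k))) by lia.
rewrite <- (Lg_sub n), acoef_slope, !bcoef_beta by lia || trivial; field; lra.
Qed.

End Grid.

(** These are the facts about the weights that the energy argument consumes; the last one trades
    division by c_{1,n} for the factor C (n tau)^alpha. *)
Lemma ccoef_properties al at0 T : 0 < al < 0.3738 -> 0 < at0 -> at0 < T ->
  exists tau0, 0 < tau0 /\ forall N, (0 < N)%nat -> tau at0 T N <= tau0 ->
    forall n, (0 < n)%nat ->
      (forall i, (1 <= i < n)%nat -> ccoef al at0 T N i n <= ccoef al at0 T N (i + 1) n) /\
      0 < ccoef al at0 T N 1 n /\
      1 <= ccoef al at0 T N 1 n * (Cal al at0 * Rpower (INR n * tau at0 T N) al).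
Proof.
intros hal hat0 hT.
destruct (l12_coef_incr (1 - al)) as [e [he incr]]; [lra |].
set (e' := Rmin e 0.01).
assert (he1 : e' <= e) by apply Rmin_l.
assert (he2 : e' <= 0.01) by apply Rmin_r.
assert (he' : 0 < e') by (apply Rmin_glb_lt; lra).
exists (e' * at0 / 2); split; [nra |].
intros N hN htau n hn.
assert (tpos := tau_pos at0 T N hT hN).
assert (gr : graded e (Lg at0 T N n) n) by (apply Lg_graded; nra).
assert (gr' : graded e' (Lg at0 T N n) n) by (apply Lg_graded; nra).
assert (hG : 0 < Gamma (2 - al)).
  replace (2 - al) with (1 - al + 1) by ring; apply Gamma_pos; lra.
assert (c1 : al / 3 * Rpower (Lg at0 T N n 0) (- al) / Gamma (2 - al) <= ccoef al at0 T N 1 n).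
  rewrite ccoef_l12 by (trivial; lra).
  apply Rmult_le_compat_r; [now apply Rlt_le, Rinv_0_lt_compat |].
  generalize (l12_coef_first_ge (1 - al) e' _ n ltac:(lra) he2 gr' hn).
  replace (1 - al - 1) with (- al) by ring; replace (1 - (1 - al)) with al by ring; trivial.
assert (L0 : 0 < Lg at0 T N n 0) by now apply (graded_pos e' _ n).
assert (K : 0 < Rpower (Lg at0 T N n 0) (- al)) by apply exp_pos.
split; [| split].
- intros i hi; destruct i as [|k]; [lia |].
  replace (S k + 1)%nat with (S (S k)) by lia.
  rewrite !ccoef_l12 by (trivial; lia || lra).
  apply Rmult_le_compat_r; [now apply Rlt_le, Rinv_0_lt_compat |].
  apply incr; [trivial | lia].
- apply Rlt_le_trans with (2 := c1).
  apply Rdiv_lt_0_compat; trivial; apply Rmult_lt_0_compat; lra.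
- set (nt := INR n * tau at0 T N).
  assert (ntpos : 0 < nt) by (apply Rmult_lt_0_compat; [apply lt_0_INR; lia | trivial]).
  assert (hL : Lg at0 T N n 0 <= nt / at0).
    unfold Lg; rewrite tk_0.
    assert (0 < tk at0 T N n) by (generalize (tk_ge at0 T N tpos n); lra).
    apply Rle_trans with (1 := ln_le_sub_1 _ (Rdiv_lt_0_compat _ _ H hat0)).
    unfold tk; fold nt; right; field; lra.
  (* This entry of the maximum cancels exactly the constants in [c1] once s_0 <= n tau / at0 is
     inserted. *)
  assert (hC : 3 * Gamma (2 - al) / (al * Rpower at0 al) <= Cal al at0) by apply Rmax_r.
  assert (A0 : 0 < Rpower at0 al) by apply exp_pos.
  assert (NT : 0 < Rpower nt al) by apply exp_pos.
  assert (hK : Rpower at0 al / Rpower nt al <= Rpower (Lg at0 T N n 0) (- al)).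
    apply Rle_trans with (Rpower (nt / at0) (- al)).
      right; rewrite Rpower_Ropp; replace nt with (nt / at0 * at0) at 1 by (field; lra).
      assert (0 < nt / at0) by now apply Rdiv_lt_0_compat.
      rewrite <- Rpower_mult_distr by trivial.
      generalize (exp_pos (al * ln (nt / at0))); fold (Rpower (nt / at0) al); intros; field; lra.
    apply Rpower_le_neg; lra.
  apply Rle_trans with (al / 3 * (Rpower at0 al / Rpower nt al) / Gamma (2 - al)
    * (3 * Gamma (2 - al) / (al * Rpower at0 al) * Rpower nt al)).
    right; field; lra.
  apply Rmult_le_compat.
  + apply Rdiv_le_0_compat; trivial; apply Rmult_le_pos; [lra |].
    apply Rlt_le; now apply Rdiv_lt_0_compat.
  + apply Rmult_le_pos; [| lra]; apply Rdiv_le_0_compat; [lra | now apply Rmult_lt_0_compat].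
  + apply Rle_trans with (2 := c1); apply Rmult_le_compat_r.
      now apply Rlt_le, Rinv_0_lt_compat.
    apply Rmult_le_compat_l; lra.
  + apply Rmult_le_compat_r; lra.
Qed.

(** * Finite sums and the Riesz matrix *)

Definition lsum (F : nat -> R) (l : list nat) : R := fold_right Rplus 0 (map F l).

Lemma lsum_cons F i l : lsum F (i :: l) = F i + lsum F l.
Proof. reflexivity. Qed.

Lemma lsum_app F l1 l2 : lsum F (l1 ++ l2) = lsum F l1 + lsum F l2.
Proof.
induction l1 as [|i l1 IH]; [unfold lsum; simpl; ring |].
rewrite <- app_comm_cons, !lsum_cons, IH; ring.
Qed.

Lemma lsum_ext F G l : (forall i, In i l -> F i = G i) -> lsum F l = lsum G l.
Proof. intros h; unfold lsum; f_equal; now apply map_ext_in. Qed.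

Lemma lsum_le F G l : (forall i, In i l -> F i <= G i) -> lsum F l <= lsum G l.
Proof.
induction l as [|i l IH]; intros h; [unfold lsum; simpl; lra |].
rewrite !lsum_cons; apply Rplus_le_compat; [apply h; now left |].
apply IH; intros; apply h; now right.
Qed.

Lemma lsum_plus F G l : lsum (fun i => F i + G i) l = lsum F l + lsum G l.
Proof.
induction l as [|i l IH]; [unfold lsum; simpl; ring |].
rewrite !lsum_cons, IH; ring.
Qed.

Lemma lsum_scal c F l : lsum (fun i => c * F i) l = c * lsum F l.
Proof.
induction l as [|i l IH]; [unfold lsum; simpl; ring |].
rewrite !lsum_cons, IH; ring.
Qed.

Lemma lsum_0 l : lsum (fun _ => 0) l = 0.
Proof. induction l as [|i l IH]; [reflexivity | rewrite lsum_cons, IH; ring]. Qed.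

Lemma lsum_ge_0 F l : (forall i, In i l -> 0 <= F i) -> 0 <= lsum F l.
Proof. intros h; rewrite <- (lsum_0 l); now apply lsum_le. Qed.

Lemma lsum_exchange F l1 l2 :
  lsum (fun i => lsum (F i) l2) l1 = lsum (fun j => lsum (fun i => F i j) l1) l2.
Proof.
induction l1 as [|i l1 IH].
  unfold lsum at 1; simpl; symmetry; apply lsum_0.
rewrite lsum_cons, IH, <- lsum_plus; apply lsum_ext; intros; now rewrite lsum_cons.
Qed.

Lemma lsum_seq_S F m n : lsum F (seq m (S n)) = lsum F (seq m n) + F (m + n)%nat.
Proof. rewrite seq_S, lsum_app; unfold lsum at 2; simpl; ring. Qed.

Lemma lsum_seq_shift F m n : lsum F (seq (S m) n) = lsum (fun i => F (S i)) (seq m n).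
Proof. unfold lsum; now rewrite <- seq_shift, map_map. Qed.

Lemma lsum_ends F n : (0 < n)%nat ->
  lsum F (seq 0 (S n)) = F 0%nat + lsum F (seq 1 (n - 1)) + F n.
Proof.
intros hn; destruct n as [|n]; [lia |].
change (seq 0 (S (S n))) with (0%nat :: seq 1 (S n)).
now rewrite lsum_cons, lsum_seq_S, Nat.sub_succ, Nat.sub_0_r, <- Rplus_assoc.
Qed.

Lemma lsum_telescope F m : lsum (fun i => F (i + 1)%nat - F i) (seq 1 m) = F (S m) - F 1%nat.
Proof.
induction m as [|m IH]; [unfold lsum; simpl; ring |].
rewrite lsum_seq_S, IH; replace (1 + m + 1)%nat with (S (S m)) by lia; simpl; ring.
Qed.

Lemma lsum_cauchy_schwarz F G l :
  lsum (fun i => F i * G i) l ^ 2 <= lsum (fun i => F i ^ 2) l * lsum (fun i => G i ^ 2) l.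
Proof.
induction l as [|i l IH]; [unfold lsum; simpl; lra |].
rewrite !lsum_cons.
assert (hA : 0 <= lsum (fun i => F i ^ 2) l) by (apply lsum_ge_0; intros; apply pow2_ge_0).
assert (hB : 0 <= lsum (fun i => G i ^ 2) l) by (apply lsum_ge_0; intros; apply pow2_ge_0).
revert IH hA hB; generalize (lsum (fun i => F i ^ 2) l) (lsum (fun i => G i ^ 2) l)
  (lsum (fun i => F i * G i) l) (F i) (G i); clear; intros A B P a b IH hA hB.
cut (0 <= a ^ 2 * B + b ^ 2 * A - 2 * a * b * P); [intros; nra |].
(* Multiplied by B, the form is a square plus b^2 (A B - P^2); if B = 0 then P = 0. *)
destruct (Rle_lt_or_eq_dec 0 B hB) as [Bpos | <-].
- apply Rmult_le_reg_l with B; trivial; rewrite Rmult_0_r.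
  replace (B * (a ^ 2 * B + b ^ 2 * A - 2 * a * b * P))
    with ((a * B - b * P) ^ 2 + b ^ 2 * (A * B - P ^ 2)) by ring.
  apply Rplus_le_le_0_compat; [apply pow2_ge_0 |].
  apply Rmult_le_pos; [apply pow2_ge_0 | lra].
- assert (P = 0) by nra; subst P.
  assert (0 <= b ^ 2 * A) by (apply Rmult_le_pos; trivial; apply pow2_ge_0); lra.
Qed.

Definition lmax (F : nat -> R) (l : list nat) : R := fold_right Rmax 0 (map F l).

Lemma lmax_ge_0 F l : 0 <= lmax F l.
Proof.
induction l as [|i l IH]; unfold lmax; simpl; [lra |].
apply Rle_trans with (1 := IH), Rmax_r.
Qed.

Lemma lmax_ge F l i : In i l -> F i <= lmax F l.
Proof.
induction l as [|j l IH]; intros [].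
- subst; apply Rmax_l.
- apply Rle_trans with (1 := IH H), Rmax_r.
Qed.

Lemma lmax_le F l1 l2 : incl l1 l2 -> lmax F l1 <= lmax F l2.
Proof.
induction l1 as [|j l1 IH]; intros h; [apply lmax_ge_0 |].
apply Rmax_lub; [apply lmax_ge, h; now left |].
apply IH; intros i hi; apply h; now right.
Qed.

(** * Signs and partial sums of the Riesz coefficients *)

Lemma fold_right_Rmult_app x l : fold_right Rmult 1 (l ++ x :: nil) = fold_right Rmult 1 l * x.
Proof. induction l as [|y l IH]; simpl; [ring | rewrite IH; ring]. Qed.

Lemma gcoef_0 be : gcoef be 0 = 1.
Proof. unfold gcoef; simpl; field. Qed.

Lemma gcoef_S be k : INR (S k) * gcoef be (S k) = (INR k - be) * gcoef be k.
Proof.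
unfold gcoef; rewrite seq_S, map_app; simpl map; rewrite fold_right_Rmult_app, fact_simpl, mult_INR.
simpl plus; rewrite <- tech_pow_Rmult.
field; split; [apply INR_fact_neq_0 | now apply not_0_INR].
Qed.

Lemma gcoef_1 be : gcoef be 1 = - be.
Proof. generalize (gcoef_S be 0); rewrite gcoef_0; simpl; lra. Qed.

Lemma gcoef_2 be : gcoef be 2 = be * (be - 1) / 2.
Proof. generalize (gcoef_S be 1); rewrite gcoef_1; simpl; lra. Qed.

Lemma gcoef_pos be k : 1 < be < 2 -> 0 <= gcoef be (S (S k)).
Proof.
intros hbe; induction k as [|k IH].
  rewrite gcoef_2; nra.
generalize (gcoef_S be (S (S k))); rewrite !S_INR.
generalize (pos_INR k); intros.
apply Rmult_le_reg_l with (INR k + 1 + 1 + 1); [lra |].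
rewrite Rmult_0_r, H0; apply Rmult_le_pos; lra.
Qed.

(** The recurrence telescopes, so the sign of a partial sum is read off the next coefficient, with
    no infinite series. *)
Lemma gcoef_sum be k : be * lsum (gcoef be) (seq 0 (S k)) = - (INR (S k) * gcoef be (S k)).
Proof.
induction k as [|k IH].
  unfold lsum; simpl; rewrite gcoef_0, gcoef_1; ring.
rewrite lsum_seq_S, Rmult_plus_distr_l, IH, (gcoef_S be (S k)), Nat.add_0_l; ring.
Qed.

Lemma gcoef_sum_le_0 be k : 1 < be < 2 -> lsum (gcoef be) (seq 0 (S (S k))) <= 0.
Proof.
intros hbe; generalize (gcoef_sum be (S k)) (gcoef_pos be k hbe) (pos_INR (S (S k))); nra.
Qed.

Lemma Psi_neg be : 1 < be < 2 -> Psi be < 0.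
Proof.
intros hbe; unfold Psi; apply Rinv_lt_0_compat.
assert (cos (PI * be / 2) < 0); [| lra].
generalize PI_RGT_0; intros; apply cos_lt_0; nra.
Qed.

Lemma rcoef_nat_S_le_0 be k : 1 < be < 2 -> rcoef_nat be (S k) <= 0.
Proof.
intros hbe; generalize (Psi_neg be hbe); intros hPsi.
destruct k as [|k]; simpl rcoef_nat.
- rewrite gcoef_0, gcoef_1, gcoef_2.
  (* The left-out factorization is (be / 2) (be - 1) (1 + be / 2). *)
  assert (0 <= be / 2 * 1 + (2 - be) / 2 * - be + be / 2 * (be * (be - 1) / 2)) by nra.
  nra.
- assert (0 <= be / 2 * gcoef be (S (S (S k)))).
    apply Rmult_le_pos; [lra | now apply gcoef_pos].
  assert (0 <= (2 - be) / 2 * gcoef be (S (S k))).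
    apply Rmult_le_pos; [lra | now apply gcoef_pos].
  nra.
Qed.

(** A row splits at the diagonal into two halves, each taking half of r_0. The extra g_0 term in r_1
    completes the first partial sum of the g_k. *)
Lemma rcoef_half_sum be k :
  rcoef_nat be 0 / 2 + lsum (rcoef_nat be) (seq 1 (S k))
  = Psi be * (be / 2 * lsum (gcoef be) (seq 0 (S (S (S k))))
              + (2 - be) / 2 * lsum (gcoef be) (seq 0 (S (S k)))).
Proof.
induction k as [|k IH].
  unfold lsum; simpl; field.
rewrite lsum_seq_S, <- Rplus_assoc, IH.
rewrite (lsum_seq_S _ 0 (S (S (S k)))), (lsum_seq_S _ 0 (S (S k))), !Nat.add_0_l.
change (1 + S k)%nat with (S (S k)); simpl rcoef_nat; ring.
Qed.

Lemma rcoef_half_sum_ge_0 be k : 1 < be < 2 ->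
  0 <= rcoef_nat be 0 / 2 + lsum (rcoef_nat be) (seq 1 k).
Proof.
intros hbe; generalize (Psi_neg be hbe); intros hPsi.
destruct k as [|k].
- unfold lsum; simpl; rewrite gcoef_0, gcoef_1.
  assert (be / 2 * - be + (2 - be) / 2 * 1 <= 0) by nra; nra.
- rewrite rcoef_half_sum.
  generalize (gcoef_sum_le_0 be (S k) hbe) (gcoef_sum_le_0 be k hbe); intros.
  assert (be / 2 * lsum (gcoef be) (seq 0 (S (S (S k)))) <= 0) by nra.
  assert ((2 - be) / 2 * lsum (gcoef be) (seq 0 (S (S k))) <= 0) by nra.
  nra.
Qed.

Lemma rcoef_sym be i j : rcoef be (Z.of_nat i - Z.of_nat j) = rcoef be (Z.of_nat j - Z.of_nat i).
Proof. unfold rcoef; f_equal; lia. Qed.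

Lemma rcoef_left_sum be j :
  lsum (fun k => rcoef be (Z.of_nat j - Z.of_nat k)) (seq 0 j) = lsum (rcoef_nat be) (seq 1 j).
Proof.
induction j as [|j IH]; [reflexivity |].
rewrite (lsum_seq_S (rcoef_nat be)), <- IH; change (seq 0 (S j)) with (0%nat :: seq 1 j).
rewrite lsum_cons, lsum_seq_shift, Rplus_comm; f_equal.
- apply lsum_ext; intros; f_equal; lia.
- unfold rcoef; f_equal; lia.
Qed.

Lemma rcoef_right_sum be j m :
  lsum (fun k => rcoef be (Z.of_nat j - Z.of_nat k)) (seq (S j) m) = lsum (rcoef_nat be) (seq 1 m).
Proof.
induction m as [|m IH]; [reflexivity |].
rewrite !lsum_seq_S, IH; unfold rcoef; do 2 f_equal; lia.
Qed.

Lemma rcoef_row_sum_ge_0 be j M : 1 < be < 2 -> (j <= M)%nat ->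
  0 <= lsum (fun k => rcoef be (Z.of_nat j - Z.of_nat k)) (seq 0 (S M)).
Proof.
intros hbe hj; replace (S M) with (j + S (M - j))%nat by lia.
rewrite seq_app, lsum_app, rcoef_left_sum; simpl seq.
rewrite lsum_cons, rcoef_right_sum.
replace (rcoef be (Z.of_nat j - Z.of_nat j)) with (rcoef_nat be 0) by (unfold rcoef; f_equal; lia).
generalize (rcoef_half_sum_ge_0 be j hbe) (rcoef_half_sum_ge_0 be (M - j) hbe); lra.
Qed.

(* Off-diagonal entries are nonpositive and row sums nonnegative, so
   [r u v >= r (u^2 + v^2) / 2] gives the quadratic form a lower bound that is a
   row-sum-weighted sum of squares. *)
Lemma rcoef_form_ge_0 be M (U : nat -> R) : 1 < be < 2 ->
  0 <= lsum (fun j => U j * lsum (fun k => rcoef be (Z.of_nat j - Z.of_nat k) * U k) (seq 0 (S M)))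
         (seq 0 (S M)).
Proof.
intros hbe; set (l := seq 0 (S M)).
set (r := fun j k => rcoef be (Z.of_nat j - Z.of_nat k)).
apply Rle_trans with (lsum (fun j => U j ^ 2 * lsum (r j) l) l).
  apply lsum_ge_0; intros j hj; apply Rmult_le_pos; [apply pow2_ge_0 |].
  apply in_seq in hj; apply rcoef_row_sum_ge_0; [trivial | lia].
apply Rle_trans with (lsum (fun j => lsum (fun k => r j k * (U j ^ 2 + U k ^ 2) / 2) l) l).
- right.
  assert (h1 : lsum (fun j => U j ^ 2 * lsum (r j) l) l = lsum (fun j => lsum (fun k => r j k * U j ^ 2) l) l).
    apply lsum_ext; intros j _; rewrite <- lsum_scal; apply lsum_ext; intros; ring.
  assert (h2 : lsum (fun j => U j ^ 2 * lsum (r j) l) l = lsum (fun j => lsum (fun k => r j k * U k ^ 2) l) l).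
    rewrite h1, lsum_exchange; apply lsum_ext; intros j _; apply lsum_ext; intros k _.
    unfold r; now rewrite rcoef_sym.
  replace (lsum (fun j => U j ^ 2 * lsum (r j) l) l) with
    (/ 2 * (lsum (fun j => lsum (fun k => r j k * U j ^ 2) l) l
      + lsum (fun j => lsum (fun k => r j k * U k ^ 2) l) l)) by lra.
  rewrite <- lsum_plus, <- lsum_scal; apply lsum_ext; intros j _.
  rewrite <- lsum_plus, <- lsum_scal; apply lsum_ext; intros; field.
- apply lsum_le; intros j _; rewrite <- lsum_scal; apply lsum_le; intros k _.
  change (r j k * (U j ^ 2 + U k ^ 2) / 2 <= U j * (r j k * U k)).
  destruct (Nat.eq_dec j k) as [-> | ne]; [right; field |].
  assert (hr : r j k <= 0).
    unfold r, rcoef; destruct (Z.abs_nat (Z.of_nat j - Z.of_nat k)) as [|m] eqn:E; [lia |].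
    now apply rcoef_nat_S_le_0.
  generalize (pow2_ge_0 (U j - U k)); nra.
Qed.

(** * Energy estimate *)

Definition ip (a b : R) (M : nat) (w v : nat -> R) : R :=
  hstep a b M * lsum (fun j => w j * v j) (seq 1 (M - 1)).

Section Norm.
Variables (a b : R) (M : nat).
Hypotheses (ab : a < b) (M_pos : (0 < M)%nat).

Lemma hstep_pos : 0 < hstep a b M.
Proof. apply Rdiv_lt_0_compat; [lra | now apply lt_0_INR]. Qed.

Lemma normhE w : normh a b M w = sqrt (hstep a b M * lsum (fun j => w j ^ 2) (seq 1 (M - 1))).
Proof. unfold normh, sumR, lsum; now replace (S (M - 1) - 1)%nat with (M - 1)%nat by lia. Qed.

Lemma sum_sqr_ge_0 w : 0 <= hstep a b M * lsum (fun j => w j ^ 2) (seq 1 (M - 1)).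
Proof.
apply Rmult_le_pos; [apply Rlt_le, hstep_pos |].
apply lsum_ge_0; intros; apply pow2_ge_0.
Qed.

Lemma normh_ge_0 w : 0 <= normh a b M w.
Proof. apply sqrt_pos. Qed.

Lemma normh_sqr w : normh a b M w ^ 2 = ip a b M w w.
Proof.
rewrite normhE, pow2_sqrt by apply sum_sqr_ge_0.
unfold ip; f_equal; apply lsum_ext; intros; ring.
Qed.

Lemma ip_le w v : ip a b M w v <= normh a b M w * normh a b M v.
Proof.
rewrite !normhE, <- sqrt_mult_alt by apply sum_sqr_ge_0.
apply Rle_trans with (1 := Rle_abs _).
rewrite <- sqrt_Rsqr_abs; apply sqrt_le_1_alt.
unfold ip, Rsqr; generalize (lsum_cauchy_schwarz w v (seq 1 (M - 1))) hstep_pos.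
generalize (lsum (fun i => w i * v i) (seq 1 (M - 1))) (lsum (fun i => w i ^ 2) (seq 1 (M - 1)))
  (lsum (fun i => v i ^ 2) (seq 1 (M - 1))) (hstep a b M); clear; intros P A B h hP h0.
replace (h * P * (h * P)) with (h ^ 2 * P ^ 2) by ring.
replace (h * A * (h * B)) with (h ^ 2 * (A * B)) by ring.
apply Rmult_le_compat_l; trivial; apply pow2_ge_0.
Qed.

(** The zero boundary values let the interior sum be extended to the full quadratic form over 0,
    ..., M. *)
Lemma ip_Riesz_ge_0 be U : 1 < be < 2 -> U 0%nat = 0 -> U M = 0 ->
  0 <= ip a b M (Riesz be a b M U) U.
Proof.
intros hbe U0 UM; apply Rmult_le_pos; [apply Rlt_le, hstep_pos |].
set (R1 := fun j => lsum (fun k => rcoef be (Z.of_nat j - Z.of_nat k) * U k) (seq 0 (S M))).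
rewrite (lsum_ext _ (fun j => Rpower (hstep a b M) (- be) * (U j * R1 j))).
  rewrite lsum_scal; apply Rmult_le_pos; [apply Rlt_le, exp_pos |].
  assert (h := rcoef_form_ge_0 be M U hbe).
  change (0 <= lsum (fun j => U j * R1 j) (seq 0 (S M))) in h.
  rewrite lsum_ends, U0, UM in h by trivial; lra.
intros j _; unfold Riesz, sumR; rewrite Nat.sub_0_r; fold (R1 j).
change (fold_right Rplus 0 _) with (R1 j); ring.
Qed.

(* Testing the scheme against [U n]: the weights [c (i+1) - c i] and [c 1] are
   nonnegative and sum to [c n], so [U n] is bounded like a convex combination
   of the previous levels. *)
Lemma energy_step (c : nat -> R) (n : nat) (U : nat -> nat -> R) (F G : nat -> R) (B : R) :
  (0 < n)%nat ->
  (forall i, (1 <= i < n)%nat -> c i <= c (i + 1)%nat) -> 0 < c 1%nat ->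
  (forall j, (1 <= j <= M - 1)%nat ->
     c n * U n j + lsum (fun i => (c i - c (i + 1)%nat) * U i j) (seq 1 (n - 1))
     - c 1%nat * U 0%nat j + G j = F j) ->
  0 <= ip a b M G (U n) ->
  (forall i, (1 <= i < n)%nat -> normh a b M (U i) <= B) ->
  c 1%nat * normh a b M (U 0%nat) + normh a b M F <= c 1%nat * B ->
  normh a b M (U n) <= B.
Proof.
intros hn mono c1 hU hG hB hF.
set (x := normh a b M (U n)).
assert (x0 : 0 <= x) by apply normh_ge_0.
(* The scheme multiplied by U^n and summed over the interior nodes. *)
assert (id : c n * ip a b M (U n) (U n)
   = lsum (fun i => (c (i + 1)%nat - c i) * ip a b M (U i) (U n)) (seq 1 (n - 1))
     + c 1%nat * ip a b M (U 0%nat) (U n) - ip a b M G (U n) + ip a b M F (U n)).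
  assert (e : ip a b M F (U n) = hstep a b M * lsum (fun j => c n * (U n j * U n j)
      + lsum (fun i => (c i - c (i + 1)%nat) * (U i j * U n j)) (seq 1 (n - 1))
      + (- c 1%nat) * (U 0%nat j * U n j) + G j * U n j) (seq 1 (M - 1))).
    unfold ip; f_equal; apply lsum_ext; intros j hj; apply in_seq in hj.
    rewrite <- hU by lia.
    rewrite (lsum_ext (fun i => (c i - c (i + 1)%nat) * (U i j * U n j))
      (fun i => U n j * ((c i - c (i + 1)%nat) * U i j))) by (intros; ring).
    rewrite lsum_scal; ring.
  rewrite e; unfold ip.
  set (P := fun i => lsum (fun j => U i j * U n j) (seq 1 (M - 1))).
  assert (e1 : lsum (fun j => lsum (fun i => (c i - c (i + 1)%nat) * (U i j * U n j)) (seq 1 (n - 1)))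
      (seq 1 (M - 1)) = - 1 * lsum (fun i => (c (i + 1)%nat - c i) * P i) (seq 1 (n - 1))).
    rewrite lsum_exchange, <- lsum_scal; apply lsum_ext; intros i _.
    rewrite lsum_scal; unfold P; ring.
  assert (e2 : lsum (fun i => (c (i + 1)%nat - c i) * (hstep a b M * P i)) (seq 1 (n - 1))
      = hstep a b M * lsum (fun i => (c (i + 1)%nat - c i) * P i) (seq 1 (n - 1))).
    rewrite <- lsum_scal; apply lsum_ext; intros; ring.
  unfold P in e1, e2; rewrite e2, !lsum_plus, e1, !lsum_scal; ring.
assert (sum : lsum (fun i => (c (i + 1)%nat - c i) * ip a b M (U i) (U n)) (seq 1 (n - 1))
   <= (c n - c 1%nat) * (B * x)).
  replace (c n) with (c (S (n - 1))) by (f_equal; lia).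
  rewrite <- lsum_telescope, Rmult_comm, <- lsum_scal.
  apply lsum_le; intros i hi; apply in_seq in hi.
  rewrite Rmult_comm; apply Rmult_le_compat_r.
    generalize (mono i ltac:(lia)); lra.
  apply Rle_trans with (1 := ip_le _ _); apply Rmult_le_compat_r; trivial; apply hB; lia.
assert (cn : c 1%nat <= c n).
  cut (forall m, (S m <= n)%nat -> c 1%nat <= c (S m)).
    intros h; replace n with (S (n - 1)) by lia; apply h; lia.
  induction m as [|m IH]; intros hm; [lra |].
  apply Rle_trans with (1 := IH ltac:(lia)).
  replace (S (S m)) with (S m + 1)%nat by lia; apply mono; lia.
rewrite <- normh_sqr in id; fold x in id.
assert (h0 := ip_le (U 0%nat) (U n)); fold x in h0.
assert (hf := ip_le F (U n)); fold x in hf.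
assert (c 1%nat * ip a b M (U 0%nat) (U n) <= c 1%nat * (normh a b M (U 0%nat) * x))
  by (apply Rmult_le_compat_l; lra).
assert ((c 1%nat * normh a b M (U 0%nat) + normh a b M F) * x <= c 1%nat * B * x)
  by (apply Rmult_le_compat_r; trivial).
(* Earlier levels contribute (c_n - c_1) B x, the initial value and the source together c_1 B x, and
   the term in [G] has a favourable sign. *)
assert (main : c n * x ^ 2 <= c n * (B * x)) by lra.
assert (Bpos : 0 <= B).
  apply Rmult_le_reg_l with (c 1%nat); trivial; rewrite Rmult_0_r.
  apply Rle_trans with (2 := hF).
  apply Rplus_le_le_0_compat; [apply Rmult_le_pos; [lra |] |]; apply normh_ge_0.
destruct (Rle_lt_or_eq_dec 0 x x0) as [xpos | <-]; trivial.
apply Rmult_le_reg_l with (c n * x); [apply Rmult_lt_0_compat; lra | lra].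
Qed.

End Norm.

Theorem theorem4p1 (al be at0 T a b : R) :
  0 < al < 0.3738 -> 1 < be < 2 -> 0 < at0 -> at0 < T -> a < b ->
  exists tau0 h0 : R, 0 < tau0 /\ 0 < h0 /\
    forall (N M : nat), (0 < N)%nat -> (0 < M)%nat ->
      tau at0 T N <= tau0 -> hstep a b M <= h0 ->
      forall (u0 : R -> R) (f : R -> R -> R) (U : nat -> nat -> R),
        scheme al be at0 T a b N M u0 f U ->
        forall n : nat, (1 <= n <= N)%nat ->
          normh a b M (U n) <=
          normh a b M (U 0%nat)
          + Cal al at0 * maxR (fun k => Rpower (INR k * tau at0 T N) al
                                          * normh a b M (fun j => f (xj a b M j) (tk at0 T N k))) 1 n.
Proof.
intros hal hbe hat0 hT hab.
destruct (ccoef_properties al at0 T hal hat0 hT) as [tau0 [tau0_pos coef]].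
exists tau0, 1; split; [trivial | split; [lra |]].
intros N M hN hM htau _ u0 f U [first [next [_ bc]]].
set (phi := fun n => normh a b M (fun j => f (xj a b M j) (tk at0 T N n))).
set (K := fun k => Rpower (INR k * tau at0 T N) al).
set (mx := fun n => lmax (fun k => K k * phi k) (seq 1 n)).
(* Positivity is read off the lower bound in [coef] at n = 1. *)
assert (Cpos : 0 < Cal al at0).
  destruct (coef N hN htau 1%nat ltac:(lia)) as [_ [c1 h]].
  assert (0 < Rpower (INR 1 * tau at0 T N) al) by apply exp_pos.
  apply Rnot_le_lt; intros neg.
  assert (Cal al at0 * Rpower (INR 1 * tau at0 T N) al <= 0) by nra; nra.
induction n as [n IH] using lt_wf_ind; intros hn.
unfold maxR; replace (S n - 1)%nat with n by lia.
change (normh a b M (U n) <= normh a b M (U 0%nat) + Cal al at0 * mx n).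
destruct (coef N hN htau n ltac:(lia)) as [mono [c1 hC]].
apply (energy_step a b M hab hM (fun i => ccoef al at0 T N i n) n U
  (fun j => f (xj a b M j) (tk at0 T N n)) (Riesz be a b M (U n))); trivial; [lia | | | |].
(* At n = 1 the history sum is empty and the first equation of the scheme has the general form. *)
- intros j hj; destruct (Nat.eq_dec n 1) as [-> | n1].
  + unfold lsum; simpl; rewrite Rplus_0_r; now apply first.
  + rewrite <- (next n j) by lia.
    unfold sumR, lsum; now replace (S (n - 1) - 1)%nat with (n - 1)%nat by lia.
- destruct (bc n) as [b0 bM]; [lia |]; now apply ip_Riesz_ge_0.
- intros i hi; specialize (IH i ltac:(lia) ltac:(lia)).
  unfold maxR in IH; replace (S i - 1)%nat with i in IH by lia.
  apply Rle_trans with (1 := IH), Rplus_le_compat_l, Rmult_le_compat_l; [lra |].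
  apply (lmax_le (fun k => K k * phi k)); intros k; rewrite !in_seq; lia.
- fold (phi n); cbv beta.
  (* The source at level n is absorbed through 1 <= c_{1,n} C (n tau)^alpha. *)
  assert (h : K n * phi n <= mx n).
    apply (lmax_ge (fun k => K k * phi k)), in_seq; lia.
  assert (p0 : 0 <= phi n) by apply normh_ge_0.
  rewrite Rmult_plus_distr_l; apply Rplus_le_compat_l.
  apply Rle_trans with (ccoef al at0 T N 1 n * (Cal al at0 * K n) * phi n).
    rewrite <- (Rmult_1_l (phi n)) at 1; now apply Rmult_le_compat_r.
  rewrite !Rmult_assoc; repeat (apply Rmult_le_compat_l; [lra |]); trivial.
Qed.
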